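(* Let $\xi,\xi_1,\xi_2,\dots$ be independent random variables with common distribution function $F$ and finite negative mean $\mathbf E\xi=-a<0$. Let $S_0=0$, $S_n=\xi_1+\cdots+\xi_n$ for $n\ge1$, let $\tau=\inf\{n\ge1:S_n\le0\}$ and $M_\tau=\max_{0\le n<\tau}S_n$. If $F\in\mathcal S^*$, then $$\mathbf P(M_\tau>x)\sim\mathbf E\tau\,\overline F(x),\qquad x\to\infty.$$
   Context: Write $\overline F(x)=1-F(x)$. A distribution function $F$ on $\mathbf R$ belongs to the class $\mathcal S^*$ (strong subexponential) if $$\int_0^x\overline F(x-y)\overline F(y)\,dy\sim 2a_+\overline F(x)\quad\text{as }x\to\infty,$$ where $a_+=\int_0^\infty\overline F(y)\,dy\in(0,\infty)$. Here $f(x)\sim g(x)$ as $x\to\infty$ means $f(x)/g(x)\to 1$ (in particular $\overline F(x)>0$ for all $x$). *)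

(* Defs.v *)
From mathcomp Require Export all_boot all_order all_algebra.
From mathcomp Require Export finmap.
From mathcomp Require Export all_classical all_reals all_analysis.
Export Order.TTheory GRing.Theory Num.Theory.
Export numFieldNormedType.Exports.

Set Implicit Arguments.
Unset Strict Implicit.
Unset Printing Implicit Defensive.

Local Open Scope classical_set_scope.
Local Open Scope ring_scope.
Local Open Scope ereal_scope.

(* Extended-real division is total; the limit 1 can only occur if g is
   eventually finite and nonzero, since 0^-1 = +oo and (+oo)^-1 = 0. *)
Definition asymp_equiv (R : realType) (f g : R -> \bar R) : Prop :=
  f x / g x @[x --> +oo%R] --> 1.

Definition tail (R : realType) (F : R -> R) (x : R) : R := (1 - F x)%R.

(* Distribution functions on R are the library's right-continuous nondecreasing
   functions with limits 0 and 1 at -oo and +oo. *)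
Definition strong_subexponential (R : realType)
    (F : cumulativeBounded (0 : R)%R (1 : R)%R) : Prop :=
  let a_plus := \int[lebesgue_measure]_(y in `[0%R, +oo[) (tail F y)%:E in
  [/\ 0 < a_plus, a_plus < +oo &
    asymp_equiv
      (fun x => \int[lebesgue_measure]_(y in `[0%R, x])
                  (tail F (x - y) * tail F y)%:E)
      (fun x => 2%:E * a_plus * (tail F x)%:E)].

Definition mutually_independent d (T : measurableType d) (R : realType)
    (P : probability T R) (X : nat -> {RV P >-> R}) : Prop :=
  forall (J : {fset nat}) (A : nat -> set R),
    (forall i, i \in J -> measurable (A i)) ->
    P (\bigcap_(i in [set` J]) (X i @^-1` A i)) =
    \prod_(i <- J) P (X i @^-1` A i).

(* S_n = xi_1 + ... + xi_n; the variable of index 0 is not a summand. *)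
Definition partial_sum (T : Type) (R : realType) (xi : nat -> T -> R)
    (n : nat) (w : T) : R :=
  (\sum_(1 <= i < n.+1) xi i w)%R.

(* The value is +oo when the walk never returns to ]-oo, 0]. *)
Definition hitting_time (T : Type) (R : realType) (xi : nat -> T -> R)
    (w : T) : \bar R :=
  ereal_inf [set n%:R%:E | n in
    [set n : nat | (1 <= n)%N /\ (partial_sum xi n w <= 0)%R]].

(* A supremum rather than a maximum only where the hitting time is +oo. *)
Definition cycle_max (T : Type) (R : realType) (xi : nat -> T -> R)
    (w : T) : \bar R :=
  ereal_sup [set (partial_sum xi n w)%:E | n in
    [set n : nat | n%:R%:E < hitting_time xi w]].

(* Main.v *)
From HB Require Import structures.
Require Import Defs.
From mathcomp Require Import ring lra measurable_realfun.

(** Write Fb for the tail of F, m for the expected hitting time tau, M for the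
    cycle maximum, a_+ for the integral of Fb over [0, +oo[, and a_- for that of
    F over ]-oo, 0[, so that a_- = a_+ + a.

    A cycle exceeds a high level by one big jump. From any position in [0, x] a
    step larger than x leads above x, hence P(M > x) is at least Fb(x) times
    the sum over n of the probabilities that the walk stays in ]0, x] up to time
    n, and this sum increases to m with x ([cycle_max_lower_bound],
    [confined_sum_near]). This half holds for every tail.

    The other half stops a supermartingale. Let h(y) be the integral of Fb over
    ]y, +oo[. Suppose that h(x - S_n) is a supermartingale as long as S_n stays
    in [0, x + L], and that it is worth b once S_n exceeds x + L. Stopping at the
    exit from ]0, x + L] yields
      b P(M > x + L) + E[h(x - S_tau); M <= x + L] <= h(x).
    Since h(x) - h(x + s) <= s Fb(x), and E|S_tau| = a m by Wald's identity,
      (b - h(x)) P(M > x + L) <= a m Fb(x).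
    Here h(x) tends to 0 and Fb(x) is equivalent to Fb(x + L); letting b tend to
    a gives P(M > x) <= (1 + o(1)) m Fb(x) ([cycle_max_upper_bound]).

    The function h is not superharmonic down to the barrier -L, where jumps
    comparable with the distance to the barrier matter. It is replaced by
    [potential], the integral of the flattened tail u |-> Fb(max(u, N)) over the
    points of [-L, +oo[ above y, with L = b / Fb(N). This function agrees with
    h from N on, and beyond the barrier it is at least b because the flat stretch
    [-L, 0] already has mass b. For N large the flattened tail hardly varies
    over the range of a typical step, wherever the step starts. The expected gain
    of the potential by upward steps is then at most about a_+ + b times the
    flattened tail, by strong subexponentiality ([upward_drift_le]), and the
    expected loss by downward steps at least about a_- = a_+ + a times the
    flattened tail, by long-tailedness ([downward_drift_ge]). Hence b < a
    suffices ([near_potential_superharmonic]).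

    Drift inequalities on the line become inequalities for the walk through
    [foster], which rests on the independence of the next step from the past.
    The same lemma, applied to y |-> (y + K)^+, shows that m is finite. *)

Set Implicit Arguments.
Unset Strict Implicit.
Unset Printing Implicit Defensive.
Local Open Scope classical_set_scope.
Local Open Scope ring_scope.
Local Open Scope ereal_scope.

(** * Integrals over intervals *)
Section lebesgue_integral_on_intervals.
Context {R : realType}.
Implicit Types (f : R -> R) (i j k : itv_bound R).
Notation mu := (@lebesgue_measure R).

Let reflection (z : R) (u : measurableTypeR R) : measurableTypeR R := (z - u)%R.

Let measurable_reflection z : measurable_fun setT (reflection z).
Proof. exact: measurable_funB. Qed.

Lemma lebesgue_measure_reflect (z : R) (A : set R) : measurable A ->
  mu ((fun u => z - u)%R @^-1` A) = mu A.
Proof.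
have mz := measurable_reflection z.
move=> mA; apply/esym.
pose nu := [the {measure set (measurableTypeR R) -> \bar R} of
  pushforward mu (reflection z)].
apply: (lebesgue_measure_unique (mu := nu mz)) => //.
move=> _ [[a b]] /= _ <-; rewrite /nu /= /pushforward /=.
have -> : (fun u : R => z - u)%R @^-1` `]a, b] = `[(z - b)%R, (z - a)%R[%classic.
  by apply/seteqP; split => u /=; rewrite !in_itv/=; lra.
rewrite !lebesgue_measure_itv/= !lte_fin ltrD2l ltrN2.
by case: ifPn => // _; rewrite -!EFinB; congr EFin; lra.
Qed.

(** Invariance of the measure gives this for every measurable integrand; tails of
    distribution functions need not be continuous. *)
Lemma ge0_integral_reflect (z : R) (D : set R) f : measurable D ->
  measurable_fun setT f -> (forall x, 0 <= f x)%R ->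
  \int[mu]_(u in (fun u => z - u)%R @^-1` D) (f (z - u)%R)%:E =
  \int[mu]_(u in D) (f u)%:E.
Proof.
move=> mD mf f0.
have mz := measurable_reflection z.
rewrite -(@ge0_integral_pushforward _ _ _ _ _ _ mz mu D (EFin \o f))//.
- apply: eq_measure_integral => A mA _.
  exact: lebesgue_measure_reflect.
- exact/measurable_funTS/measurable_EFinP.
- by move=> y _; rewrite /= lee_fin.
Qed.

Lemma ge0_integral_itv_split i j k f : (i <= j)%O -> (j <= k)%O ->
  measurable_fun setT f -> (forall x, 0 <= f x)%R ->
  \int[mu]_(u in [set` Interval i k]) (f u)%:E =
  \int[mu]_(u in [set` Interval i j]) (f u)%:E +
  \int[mu]_(u in [set` Interval j k]) (f u)%:E.
Proof.
move=> ij jk mf f0; rewrite (itv_bndbnd_setU ij jk) ge0_integral_setU//.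
- exact/measurable_funTS/measurable_EFinP.
- by move=> x _; rewrite lee_fin.
- apply/disj_setPLR => x /=; rewrite !itv_boundlr => /andP[_ xj] /andP[jx _].
  by have := le_trans xj jx; rewrite bnd_simp ltxx.
Qed.

Lemma ge0_integral_itv_le (a b c : R) (s t : bool) f : (a <= b)%R -> (0 <= c)%R ->
  measurable_fun setT f -> (forall x, 0 <= f x)%R ->
  (forall x, a <= x -> x <= b -> f x <= c)%R ->
  \int[mu]_(u in [set` Interval (BSide s a) (BSide t b)]) (f u)%:E
    <= (c * (b - a))%:E.
Proof.
move=> ab c0 mf f0 fc.
apply: (@le_trans _ _ (\int[mu]_(u in [set` Interval (BSide s a) (BSide t b)]) c%:E)).
  apply: ge0_le_integral => //.
  - by move=> x _; rewrite lee_fin.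
  - exact/measurable_funTS/measurable_EFinP.
  - move=> x /= /[!itv_boundlr] /andP[ax xb]; rewrite lee_fin; apply: fc.
    + by move: ax; case: s; rewrite bnd_simp => // /ltW.
    + by move: xb; case: t; rewrite bnd_simp => // /ltW.
rewrite integral_cst//= lebesgue_measure_itv/= lte_fin EFinM.
by case: ifPn => _; rewrite ?EFinB// mule0 lee_fin mulr_ge0// subr_ge0.
Qed.

Lemma ge0_integral_itv_ge (a b c : R) (s t : bool) f : (a <= b)%R -> (0 <= c)%R ->
  measurable_fun setT f -> (forall x, 0 <= f x)%R ->
  (forall x, a <= x -> x <= b -> c <= f x)%R ->
  (c * (b - a))%:E <=
  \int[mu]_(u in [set` Interval (BSide s a) (BSide t b)]) (f u)%:E.
Proof.
move=> ab c0 mf f0 fc.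
apply: (@le_trans _ _ (\int[mu]_(u in [set` Interval (BSide s a) (BSide t b)]) c%:E)).
  rewrite integral_cst//= lebesgue_measure_itv/= lte_fin EFinM.
  case: ifPn => [_|]; rewrite ?EFinB// -leNgt => ba.
  by rewrite mule0 (@le_anti _ _ b a) ?ba ?ab// subee// mule0.
apply: ge0_le_integral => //.
- exact/measurable_funTS/measurable_EFinP.
- move=> x /= /[!itv_boundlr] /andP[ax xb]; rewrite lee_fin; apply: fc.
  + by move: ax; case: s; rewrite bnd_simp => // /ltW.
  + by move: xb; case: t; rewrite bnd_simp => // /ltW.
Qed.

Lemma ge0_le_integral_real (D : set R) (f g : R -> R) : measurable D ->
  measurable_fun setT f -> measurable_fun setT g -> (forall x, 0 <= f x)%R ->
  (forall x, D x -> f x <= g x)%R ->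
  \int[mu]_(x in D) (f x)%:E <= \int[mu]_(x in D) (g x)%:E.
Proof.
move=> mD mf mg f0 fg; apply: ge0_le_integral => //.
- by move=> x _; rewrite lee_fin.
- exact/measurable_funTS/measurable_EFinP.
- exact/measurable_funTS/measurable_EFinP.
Qed.

Lemma ge0_subset_integral_real (A B : set R) (f : R -> R) : measurable A ->
  measurable B -> measurable_fun setT f -> (forall x, 0 <= f x)%R -> A `<=` B ->
  \int[mu]_(x in A) (f x)%:E <= \int[mu]_(x in B) (f x)%:E.
Proof.
move=> mA mB mf f0 AB; apply: ge0_subset_integral => //.
- exact/measurable_funTS/measurable_EFinP.
- by move=> x _; rewrite lee_fin.
Qed.

Lemma ge0_integralZl_real (D : set R) (c : R) (f : R -> R) : measurable D ->
  (0 <= c)%R -> measurable_fun setT f -> (forall x, 0 <= f x)%R ->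
  \int[mu]_(x in D) (c * f x)%:E = c%:E * \int[mu]_(x in D) (f x)%:E.
Proof.
move=> mD c0 mf f0; rewrite -ge0_integralZl_EFin//.
- by move=> x _; rewrite lee_fin.
- exact/measurable_funTS/measurable_EFinP.
Qed.

Lemma measurable_reflect (z : R) (f : R -> R) : measurable_fun setT f ->
  measurable_fun setT (fun u : R => f (z - u)%R).
Proof. move=> mf; apply: (measurableT_comp mf).
exact: (@measurable_funB _ _ _ _ (cst z) id). Qed.

Lemma ge0_cvg_integral_itvy (f : R -> R) (a k : R) :
  measurable_fun setT f -> (forall x, 0 <= f x)%R ->
  k%:E < \int[mu]_(y in `[a, +oo[) (f y)%:E ->
  \forall x \near +oo%R, k%:E < \int[mu]_(y in `[a, x[) (f y)%:E.
Proof.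
move=> mf f0.
have -> : `[a, +oo[%classic = \bigcup_n `[a, (a + n%:R)%R[%classic.
  apply/seteqP; split => [y /=|y [n _] /=]; rewrite !in_itv/= ?andbT.
    move=> ay; exists (Num.truncn (y - a)).+1 => //=; rewrite in_itv/= ay/=.
    by rewrite -ltrBlDl truncnS_gt.
  by case/andP.
move=> kI.
have cv : \int[mu]_(y in `[a, (a + n%:R)%R[) (f y)%:E @[n --> \oo] -->
    \int[mu]_(y in \bigcup_n `[a, (a + n%:R)%R[%classic) (f y)%:E.
  apply: (@ge0_nondecreasing_set_cvg_integral _ (measurableTypeR R) R
    (fun n => `[a, (a + n%:R)%R[%classic) (EFin \o f) mu).
  - move=> m n mn; apply/subsetPset; apply: subset_itvl.
    by rewrite bnd_simp lerD2l ler_nat.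
  - by [].
  - by move=> i; apply/measurable_funTS/measurable_EFinP.
  - by move=> i x _; rewrite lee_fin.
have : \forall n \near \oo, k%:E < \int[mu]_(y in `[a, (a + n%:R)%R[) (f y)%:E.
  exact: (cv _ (open_ereal_gt' kI)).
move=> /filter_ex[n kn].
near=> x; apply: lt_le_trans kn _; apply: ge0_subset_integral_real => //.
apply: subset_itvl; rewrite bnd_simp.
  by near: x; apply: nbhs_pinfty_ge; exact: num_real.
Unshelve. all: by end_near. Qed.

Lemma ge0_integral_itvy_truncate (f : R -> R) (a c k : R) :
  measurable_fun setT f -> (forall x, 0 <= f x)%R ->
  k%:E < \int[mu]_(y in `[a, +oo[) (f y)%:E ->
  exists2 A, (c <= A)%R & k%:E < \int[mu]_(y in `[a, A[) (f y)%:E.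
Proof.
move=> mf f0 kI.
have : \forall A \near +oo%R, (c <= A)%R /\ k%:E < \int[mu]_(y in `[a, A[) (f y)%:E.
  apply: filterI; first by apply: nbhs_pinfty_ge; exact: num_real.
  exact: ge0_cvg_integral_itvy.
by move=> /filter_ex[A [cA kA]]; exists A.
Qed.

Lemma near_pinfty_forall_ge (Q : R -> Prop) : (\forall x \near +oo%R, Q x) ->
  \forall N \near +oo%R, forall x, (N <= x)%R -> Q x.
Proof.
move=> [M [Mr MQ]]; exists M; split => // N MN x Nx.
by apply: MQ; exact: lt_le_trans MN Nx.
Qed.

End lebesgue_integral_on_intervals.

(** * Strongly subexponential tails *)
Section tail_of_a_distribution_function.
Context {R : realType} (F : cumulativeBounded (0 : R)%R (1 : R)%R).
Notation mu := (@lebesgue_measure R).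
Notation Fb := (tail F).

Lemma df_nondecreasing (x y : R) : (x <= y)%R -> (F x <= F y)%R.
Proof. exact: cumulative_is_nondecreasing. Qed.

Lemma df_ge0 (x : R) : (0 <= F x)%R.
Proof.
rewrite leNgt; apply/negP => Fx0.
have h := cvgr_gt _ (cumulativeNy F) _ Fx0.
have : \forall y \near -oo%R, (F x < F y)%R /\ (y <= x)%R.
  by apply: filterI; [exact: h|exact: nbhs_ninfty_le].
by move=> /filter_ex[y [xy /df_nondecreasing]]; rewrite leNgt xy.
Qed.

Lemma df_le1 (x : R) : (F x <= 1)%R.
Proof.
rewrite leNgt; apply/negP => Fx0.
have h := cvgr_lt _ (cumulativey F) _ Fx0.
have : \forall y \near +oo%R, (F y < F x)%R /\ (x <= y)%R.
  by apply: filterI; [exact: h|exact: nbhs_pinfty_ge].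
by move=> /filter_ex[y [xy /df_nondecreasing]]; rewrite leNgt xy.
Qed.

Lemma tail_ge0 (x : R) : (0 <= Fb x)%R.
Proof. by rewrite /tail subr_ge0 df_le1. Qed.

Lemma tail_nonincreasing (x y : R) : (x <= y)%R -> (Fb y <= Fb x)%R.
Proof. by move=> /df_nondecreasing; rewrite /tail; lra. Qed.

Lemma measurable_df : measurable_fun setT (F : R -> R).
Proof. by apply: nondecreasing_measurable => //; exact: df_nondecreasing. Qed.

Lemma measurable_tail : measurable_fun setT Fb.
Proof. by apply: nonincreasing_measurable => //; exact: tail_nonincreasing. Qed.

Lemma tail_cvg0 : Fb x @[x --> +oo%R] --> (0 : R)%R.
Proof.
have : Fb x @[x --> +oo%R] --> (1 - 1 : R)%R.
  by apply: cvgB; [exact: cvg_cst|exact: cumulativey].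
by rewrite subrr.
Qed.

Section subexponential.
Hypothesis F_strong : strong_subexponential F.

Definition tail_mass : R :=
  fine (\int[mu]_(y in `[0%R, +oo[) (Fb y)%:E).

Lemma tail_massE :
  \int[mu]_(y in `[0%R, +oo[) (Fb y)%:E = tail_mass%:E.
Proof.
case: F_strong => p f _; rewrite /tail_mass fineK//.
by rewrite ge0_fin_numE// ltW.
Qed.

Lemma tail_mass_gt0 : (0 < tail_mass)%R.
Proof. by case: F_strong => p _ _; rewrite -lte_fin -tail_massE. Qed.

(** A vanishing tail would make the quotient in the definition 0 or +oo, because
    0^-1 = +oo; a limit equal to 1 excludes both. *)
Lemma conv_tail_near (e : R) : (0 < e)%R ->
  \forall x \near +oo%R, (0 < Fb x)%R /\
   \int[mu]_(y in `[0%R, x]) (Fb (x - y) * Fb y)%:E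
     <= ((2 * tail_mass + e) * Fb x)%:E.
Proof.
move=> e0; case: F_strong => _ _; rewrite tail_massE => lim.
have t0 := tail_mass_gt0.
pose d := (e / (2 * tail_mass))%R.
have d0 : (0 < d)%R by rewrite divr_gt0// mulr_gt0.
have h1 : (1 : \bar R) < (1 + d)%:E by rewrite lte_fin; lra.
have h0 : ((1/2)%:E : \bar R) < 1 by rewrite lte_fin; lra.
pose q x := \int[mu]_(y in `[0%R, x]) (Fb (x - y) * Fb y)%:E /
  (2 * tail_mass%:E * (Fb x)%:E).
have near1 : \forall x \near +oo%R, q x < (1 + d)%:E := lim _ (open_ereal_lt' h1).
have near0 : \forall x \near +oo%R, (1/2)%:E < q x := lim _ (open_ereal_gt' h0).
near=> x.
have : q x < (1 + d)%:E by near: x; exact: near1.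
have : (1/2)%:E < q x by near: x; exact: near0.
rewrite /q -!EFinM; set I := integral _ _ _.
have I0 : 0 <= I.
  by apply: integral_ge0 => y _; rewrite lee_fin mulr_ge0// tail_ge0.
have [Fx0|Fx0] := eqVneq (Fb x) 0%R.
  rewrite Fx0 mulr0 inve0; have [->|I1] := eqVneq I 0.
    rewrite mul0e lte_fin => h _; exfalso; move: h.
    by rewrite ltNge => /negP; apply; rewrite divr_ge0.
  by rewrite gt0_muley ?lt0e ?I1 ?I0.
have Fx : (0 < Fb x)%R by rewrite lt0r Fx0 tail_ge0.
move=> _; rewrite inver mulf_eq0 (negbTE Fx0) orbF gt_eqF ?mulr_gt0//.
rewrite lte_pdivrMr ?mulr_gt0// => h; split => //.
rewrite (le_trans (ltW h))// -EFinM lee_fin mulrA ler_pM2r// /d.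
rewrite mulrDl mul1r divfK//; by rewrite gt_eqF// mulr_gt0.
Unshelve. all: by end_near. Qed.

Lemma tail_gt0 (x : R) : (0 < Fb x)%R.
Proof.
have : \forall y \near +oo%R, (0 < Fb y)%R /\ (x <= y)%R.
  apply: filterI; last by apply: nbhs_pinfty_ge; exact: num_real.
  by apply: filterS (conv_tail_near ltr01) => y [].
by move=> /filter_ex[y [y0 /tail_nonincreasing]]; exact: lt_le_trans.
Qed.

(** Strong subexponentiality implies long-tailedness. The two ends [0, A[ and
    ]x - A, x] contribute equally to the convolution, hence [0, A[ contributes at
    most about [tail_mass * Fb x]. As Fb (x - y) >= Fb x, and the excess is at
    least Fb (x - L) - Fb x for y in [L, A[, this excess must be small compared
    with Fb x. *)
Lemma tail_long (L e : R) : (0 <= L)%R -> (0 < e)%R ->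
  \forall x \near +oo%R, (Fb (x - L) <= (1 + e) * Fb x)%R.
Proof.
move=> L0 e0.
have mF := measurable_tail.
(* c is a lower bound of the mass of the tail on [L, A[. *)
pose c := Fb (L + 1).
have c0 : (0 < c)%R by exact: tail_gt0.
pose d := (c * e / 4)%R.
have d0 : (0 < d)%R by rewrite divr_gt0// mulr_gt0.
have kA : (tail_mass - d)%:E < \int[mu]_(y in `[0%R, +oo[) (Fb y)%:E.
  by rewrite tail_massE lte_fin; lra.
have [A LA hA] := ge0_integral_itvy_truncate (L + 1) mF tail_ge0 kA.
near=> x.
have [_ cx] : (0 < Fb x)%R /\
   \int[mu]_(y in `[0%R, x]) (Fb (x - y) * Fb y)%:E
     <= ((2 * tail_mass + d) * Fb x)%:E.
  by near: x; exact: conv_tail_near.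
have xA : (2 * A <= x)%R by near: x; apply: nbhs_pinfty_ge; exact: num_real.
pose g y := (Fb (x - y) * Fb y)%R.
have mg : measurable_fun setT g.
  by apply: measurable_funM => //; exact: measurable_reflect.
have g0 y : (0 <= g y)%R by rewrite mulr_ge0// tail_ge0.
have A0 : (0 <= A)%R by lra.
have fx := tail_gt0 x.
have sym : \int[mu]_(y in `](x - A)%R, x]) (g y)%:E =
    \int[mu]_(y in `[0%R, A[) (g y)%:E.
  rewrite -(@ge0_integral_reflect R x `[0%R, A[%classic)//.
  have -> : (fun u : R => x - u)%R @^-1` `[0%R, A[ = `](x - A)%R, x]%classic.
    by apply/seteqP; split => u /=; rewrite !in_itv/=; lra.
  apply: eq_integral => y _; rewrite /g; congr EFin.
  by rewrite subKr [RHS]mulrC.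
have twice : \int[mu]_(y in `[0%R, A[) (g y)%:E + \int[mu]_(y in `[0%R, A[) (g y)%:E
   <= ((2 * tail_mass + d) * Fb x)%:E.
  apply: le_trans cx.
  rewrite (@ge0_integral_itv_split R (BLeft 0%R) (BRight (x - A)%R) (BRight x))//; last 2 first.
  - by rewrite bnd_simp; lra.
  - by rewrite bnd_simp; lra.
  rewrite sym leeD2r// ge0_subset_integral_real//.
  by apply: subset_itvl; rewrite bnd_simp; lra.
have low : (Fb x)%:E * \int[mu]_(y in `[0%R, A[) (Fb y)%:E +
    (Fb (x - L) - Fb x)%:E * \int[mu]_(y in `[L, A[) (Fb y)%:E <=
    \int[mu]_(y in `[0%R, A[) (g y)%:E.
  have splt f := @ge0_integral_itv_split R (BLeft 0%R) (BLeft L) (BLeft A) f.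
  rewrite splt//; [|by rewrite bnd_simp; lra..|exact: tail_ge0].
  rewrite splt//; [|by rewrite bnd_simp; lra..].
  rewrite ge0_muleDr; [|by apply: integral_ge0 => y _; rewrite lee_fin tail_ge0..].
  rewrite -addeA -ge0_muleDl ?lee_fin ?tail_ge0 ?subr_ge0 ?tail_nonincreasing ?gerBl//.
  rewrite -EFinD (addrC (Fb x)) subrK.
  have mc c' : measurable_fun setT (fun u => c' * Fb u)%R by exact: measurable_funM.
  rewrite -!ge0_integralZl_real ?tail_ge0//; [|exact: tail_ge0..].
  apply: leeD; apply: ge0_le_integral_real => //.
  - by move=> y; rewrite mulr_ge0// tail_ge0.
  - move=> y /=; rewrite in_itv/= => /andP[y0 _].
    by rewrite ler_wpM2r ?tail_ge0// tail_nonincreasing// gerBl.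
  - by move=> y; rewrite mulr_ge0// tail_ge0.
  - move=> y /=; rewrite in_itv/= => /andP[y0 _].
    by rewrite ler_wpM2r ?tail_ge0// tail_nonincreasing// lerD2l lerN2.
have cL : c%:E <= \int[mu]_(y in `[L, A[) (Fb y)%:E.
  apply: (@le_trans _ _ (\int[mu]_(y in `[L, (L + 1)%R[) (Fb y)%:E)).
    apply: le_trans (@ge0_integral_itv_ge R L (L+1)%R c true true Fb _ _ _ _ _) => //.
    - by rewrite lee_fin; lra.
    - lra.
    - exact: ltW.
    - exact: tail_ge0.
    - by move=> y _ yL; exact: tail_nonincreasing.
  apply: ge0_subset_integral_real => //; first exact: tail_ge0.
  by apply: subset_itvl; rewrite bnd_simp; lra.
have dx : (0 <= Fb (x - L) - Fb x)%R by rewrite subr_ge0 tail_nonincreasing// gerBl.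
have hc : ((Fb x)%:E * (tail_mass - d)%:E + (Fb (x - L) - Fb x)%:E * c%:E) <= 
   \int[mu]_(y in `[0%R, A[) (g y)%:E.
  apply: le_trans low; apply: leeD; apply: lee_wpmul2l; rewrite ?lee_fin ?tail_ge0//.
  exact: ltW.
have := le_trans (leeD hc hc) twice.
rewrite -!EFinM -!EFinD lee_fin => H.
have H' : (c * Fb (x - L) <= c * ((1 + e) * Fb x))%R.
  have ef : (0 <= c * e * Fb x)%R by rewrite !mulr_ge0// ltW.
  by move: H; rewrite /d; lra.
by rewrite ler_pM2l in H'.
Unshelve. all: by end_near. Qed.


(** * A test function with negative drift *)

(** Flattened below N so as to vary slowly everywhere, and not only near +oo. *)
Definition flat_tail (N u : R) : R := Fb (Num.max u N).

Lemma flat_tail_ge0 (N u : R) : (0 <= flat_tail N u)%R.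
Proof. exact: tail_ge0. Qed.

Lemma flat_tail_nonincreasing (N x y : R) : (x <= y)%R ->
  (flat_tail N y <= flat_tail N x)%R.
Proof.
by move=> xy; apply: tail_nonincreasing; rewrite ge_max !le_max xy lexx orbT.
Qed.

Lemma measurable_flat_tail (N : R) : measurable_fun setT (flat_tail N).
Proof.
by apply: nonincreasing_measurable => // x y; exact: flat_tail_nonincreasing.
Qed.

Lemma flat_tail_le_tail (N u : R) : (flat_tail N u <= Fb u)%R.
Proof. by apply: tail_nonincreasing; rewrite le_max lexx. Qed.

Lemma flat_tail_le (N u : R) : (flat_tail N u <= Fb N)%R.
Proof. by apply: tail_nonincreasing; rewrite le_max lexx orbT. Qed.

Lemma flat_tail_low (N u : R) : (u <= N)%R -> flat_tail N u = Fb N.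
Proof. by move=> uN; rewrite /flat_tail max_r. Qed.

Lemma flat_tail_high (N u : R) : (N <= u)%R -> flat_tail N u = Fb u.
Proof. by move=> uN; rewrite /flat_tail max_l. Qed.

(** Above N the integral splits at 0 and at a fixed K. The flattened tail has mass
    b on [- (b / Fb N), 0[, and is at most Fb N on [0, K[, which makes that part
    negligible. On [K, z[ it is at most the tail, and the convolution there is
    about [tail_mass * Fb z]: half of the total, the other half coming from
    [0, K[. *)
Lemma upward_drift_le (b k : R) : (0 <= b)%R -> (tail_mass + b < k)%R ->
  \forall N \near +oo%R, forall z : R, (- (b / Fb N) <= z)%R ->
    \int[mu]_(u in `[(- (b / Fb N))%R, z[) (flat_tail N u * Fb (z - u))%:E
      <= (k * flat_tail N z)%:E.
Proof.
move=> b0 bk; have mF := measurable_tail.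
pose e := (k - tail_mass - b)%R.
have e4 : (0 < e / 4)%R by rewrite divr_gt0// /e; lra.
have kA : (tail_mass - e / 4)%:E < \int[mu]_(y in `[0%R, +oo[) (Fb y)%:E.
  by rewrite tail_massE lte_fin; lra.
have [K K1 hK] := ge0_integral_itvy_truncate 1 mF tail_ge0 kA.
have K0 : (0 < K)%R by exact: lt_le_trans K1.
have eK : (0 < e / 4 / K)%R by rewrite divr_gt0.
near=> N.
have NK : (K <= N)%R by near: N; apply: nbhs_pinfty_ge; exact: num_real.
have FN : (Fb N < e / 4 / K)%R by near: N; exact: (cvgr_lt _ tail_cvg0).
have conv : forall x, (N <= x)%R -> \int[mu]_(y in `[0%R, x]) (Fb (x - y) * Fb y)%:E
     <= ((2 * tail_mass + e / 4) * Fb x)%:E.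
  near: N; apply: near_pinfty_forall_ge.
  by apply: filterS (conv_tail_near e4) => y [].
have long : forall x, (N <= x)%R -> (Fb (x - K) <= (1 + 1) * Fb x)%R.
  by near: N; apply: near_pinfty_forall_ge; apply: tail_long => //; exact: ltW.
move=> z Lz.
have fN := tail_gt0 N.
have fz := tail_gt0 z.
have LN0 : (0 <= b / Fb N)%R by rewrite divr_ge0// ltW.
set L := (b / Fb N)%R in Lz LN0 *.
pose g u := (flat_tail N u * Fb (z - u))%R.
have mg : measurable_fun setT g.
  by apply: measurable_funM; [exact: measurable_flat_tail|exact: measurable_reflect].
have g0 u : (0 <= g u)%R by rewrite mulr_ge0// tail_ge0.
(* Below N the weight is the constant Fb N. *)
have [zN|Nz] := leP z N.
  rewrite (flat_tail_low zN).
  have mr : measurable_fun setT (fun u : R => Fb (z - u)%R) by exact: measurable_reflect.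
  apply: (@le_trans _ _ (\int[mu]_(u in `[(- L)%R, z[) (Fb N * Fb (z - u))%:E)).
    apply: ge0_le_integral_real => //; first exact: measurable_funM.
    by move=> u _; rewrite ler_wpM2r ?tail_ge0// flat_tail_le.
  rewrite ge0_integralZl_real ?tail_ge0//; last by move=> u; exact: tail_ge0.
  have -> : `[(- L)%R, z[%classic = (fun u : R => z - u)%R @^-1` `]0%R, (z + L)%R].
    by apply/seteqP; split => u /=; rewrite !in_itv/=; lra.
  rewrite (@ge0_integral_reflect R z _ Fb)//; last exact: tail_ge0.
  apply: (@le_trans _ _ ((Fb N)%:E * tail_mass%:E)).
    apply: lee_wpmul2l; first by rewrite lee_fin ltW.
    rewrite -tail_massE; apply: ge0_subset_integral_real => //; first exact: tail_ge0.
    by apply: subset_itv; rewrite bnd_simp.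
  by rewrite -EFinM lee_fin mulrC ler_pM2r//; lra.
rewrite (flat_tail_high (ltW Nz)).
have part1 : \int[mu]_(u in `[(- L)%R, 0%R[) (g u)%:E <= (b * Fb z)%:E.
  apply: le_trans (@ge0_integral_itv_le R (- L) 0 (Fb N * Fb z) true true g _ _ _ _ _) _ => //.
  - by rewrite oppr_le0.
  - by rewrite mulr_ge0// ltW.
  - move=> u _ u0; apply: ler_pM; rewrite ?tail_ge0 ?flat_tail_ge0 ?flat_tail_le//.
    by apply: tail_nonincreasing; lra.
  - rewrite lee_fin sub0r opprK mulrAC /L mulrCA divff ?mulr1 ?gt_eqF//.
have part2 : \int[mu]_(u in `[0%R, K[) (g u)%:E <= (e / 2 * Fb z)%:E.
  apply: le_trans (@ge0_integral_itv_le R 0 K (Fb N * Fb (z - K)) true true g _ _ _ _ _) _ => //.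
  - exact: ltW.
  - by rewrite mulr_ge0// tail_ge0.
  - move=> u u0 uK; apply: ler_pM; rewrite ?tail_ge0 ?flat_tail_ge0 ?flat_tail_le//.
    by apply: tail_nonincreasing; lra.
  - rewrite lee_fin subr0.
    have h1 : (Fb N * K <= e / 4)%R by rewrite -ler_pdivlMr// ltW.
    have h2 := long z (ltW Nz).
    have h3 : (0 <= Fb N * K)%R by rewrite mulr_ge0// ltW.
    have h4 : (0 <= Fb (z - K))%R by exact: tail_ge0.
    by nra.
have part3 : \int[mu]_(u in `[K, z[) (g u)%:E <= ((tail_mass + e / 2) * Fb z)%:E.
  pose q u := (Fb (z - u) * Fb u)%R.
  have mq : measurable_fun setT q.
    by apply: measurable_funM => //; exact: measurable_reflect.
  have q0 u : (0 <= q u)%R by rewrite mulr_ge0// tail_ge0.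
  apply: (@le_trans _ _ (\int[mu]_(u in `[K, z]) (q u)%:E)).
    apply: (@le_trans _ _ (\int[mu]_(u in `[K, z[) (q u)%:E)).
      apply: ge0_le_integral_real => // u _.
      by rewrite /g mulrC ler_wpM2l ?tail_ge0// flat_tail_le_tail.
    apply: ge0_subset_integral_real => //.
    by apply: subset_itvl; rewrite bnd_simp.
  have := conv z (ltW Nz).
  rewrite (@ge0_integral_itv_split R (BLeft 0%R) (BLeft K) (BRight z) q)//; last 2 first.
  - by rewrite bnd_simp ltW.
  - by rewrite bnd_simp (le_trans NK)// ltW.
  have low : ((tail_mass - e / 4) * Fb z)%:E <= \int[mu]_(u in `[0%R, K[) (q u)%:E.
    apply: (@le_trans _ _ (\int[mu]_(u in `[0%R, K[) (Fb z * Fb u)%:E)).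
      rewrite ge0_integralZl_real ?tail_ge0//; last exact: tail_ge0.
      by rewrite mulrC EFinM lee_wpmul2l ?lee_fin ?ltW.
    apply: ge0_le_integral_real => //; first exact: measurable_funM.
      by move=> x; rewrite mulr_ge0// tail_ge0.
    move=> u /=; rewrite in_itv/= => /andP[u0 _].
    by rewrite ler_wpM2r ?tail_ge0// tail_nonincreasing//; lra.
  move=> up; have {low up} := le_trans (leeD2r _ low) up.
  case: (\int[mu]_(u in `[K, z]) (q u)%:E) => [r| |]//; last by move=> _; rewrite leNye.
  by rewrite -EFinD !lee_fin; lra.
change (\int[mu]_(u in `[(- L)%R, z[) (g u)%:E <= (k * Fb z)%:E).
rewrite (@ge0_integral_itv_split R (BLeft (- L)%R) (BLeft 0%R) (BLeft z) g)//; last 2 first.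
- by rewrite bnd_simp oppr_le0.
- by rewrite bnd_simp; lra.
rewrite (@ge0_integral_itv_split R (BLeft 0%R) (BLeft K) (BLeft z) g)//; last 2 first.
- by rewrite bnd_simp; lra.
- by rewrite bnd_simp; lra.
apply: le_trans (leeD part1 (leeD part2 part3)) _.
by rewrite -!EFinD lee_fin /e; lra.
Unshelve. all: by end_near. Qed.

(** All but little of the mass of F on ]-oo, 0[ lies within a distance B of 0, and
    over a distance B the flattened tail decreases by a factor close to 1,
    uniformly in z, by long-tailedness at max z N. *)
Lemma downward_drift_ge (c k : R) : (0 < k)%R -> (k < c)%R ->
  \int[mu]_(u in `]-oo, 0%R[) (F u)%:E = c%:E ->
  \forall N \near +oo%R, forall z : R,
    (k * flat_tail N z)%:E <=
    \int[mu]_(u in `[z, +oo[) (flat_tail N u * F (z - u))%:E.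
Proof.
move=> k0 kc; have mF := measurable_df.
have -> : \int[mu]_(u in `]-oo, 0%R[) (F u)%:E =
          \int[mu]_(u in `[0%R, +oo[) (F (0 - u))%:E.
  rewrite integral_itv_bndo_bndc; last exact/measurable_funTS/measurable_EFinP.
  rewrite -(@ge0_integral_reflect R 0%R)//; last exact: df_ge0.
  by congr integral; apply/seteqP; split => u /=; rewrite !in_itv/= ?andbT; lra.
move=> cI; pose k' := ((k + c) / 2)%R.
have kk' : (k < k')%R by rewrite /k'; lra.
have k'I : k'%:E < \int[mu]_(u in `[0%R, +oo[) (F (0 - u))%:E.
  by rewrite cI lte_fin /k'; lra.
have mr : measurable_fun setT (fun u : R => F (0 - u)%R) by exact: measurable_reflect.
have mr0 t : (0 <= F (0 - t))%R by exact: df_ge0.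
have [B B1 hB] := ge0_integral_itvy_truncate 1 mr mr0 k'I.
have B0 : (0 < B)%R by exact: lt_le_trans B1.
pose e := ((k' - k) / k)%R.
have e0 : (0 < e)%R by rewrite divr_gt0// subr_gt0.
near=> N.
have long : forall x, (N <= x)%R -> (Fb (x - B) <= (1 + e) * Fb x)%R.
  by near: N; apply: near_pinfty_forall_ge; apply: tail_long => //; exact: ltW.
move=> z.
have step : (k * flat_tail N z <= k' * flat_tail N (z + B))%R.
  have h1 : (flat_tail N z <= (1 + e) * Fb (Num.max z N + B))%R.
    rewrite /flat_tail -[X in (Fb X <= _)%R](addrK B (Num.max z N)); apply: long.
    by rewrite -[N in X in (X <= _)%R]addr0 lerD ?le_max ?lexx ?orbT// ltW.
  have h2 : (Fb (Num.max z N + B) <= flat_tail N (z + B))%R.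
    apply: tail_nonincreasing; rewrite ge_max lerD2r le_max lexx/=.
    by rewrite -[N in X in (X <= _)%R]addr0 lerD ?le_max ?lexx ?orbT// ltW.
  have -> : k' = (k * (1 + e))%R.
    by rewrite mulrDr mulr1 /e mulrCA divff ?gt_eqF// mulr1 addrC subrK.
  rewrite -mulrA ler_pM2l// (le_trans h1)// ler_pM2l//; lra.
pose g u := (flat_tail N u * F (z - u))%R.
have mzr : measurable_fun setT (fun u : R => F (z - u)%R) by exact: measurable_reflect.
have mg : measurable_fun setT g.
  by apply: measurable_funM => //; exact: measurable_flat_tail.
have g0 u : (0 <= g u)%R by rewrite mulr_ge0// ?df_ge0 ?tail_ge0.
apply: (@le_trans _ _ (\int[mu]_(u in `[z, (z + B)%R[) (g u)%:E)); last first.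
  by apply: ge0_subset_integral_real => //; apply: subset_itvl; rewrite bnd_simp.
apply: (@le_trans _ _ (\int[mu]_(u in `[z, (z + B)%R[)
    (flat_tail N (z + B) * F (z - u))%:E)); last first.
  apply: ge0_le_integral_real => //; first exact: measurable_funM.
    by move=> u; rewrite mulr_ge0// ?df_ge0 ?tail_ge0.
  move=> u /=; rewrite in_itv/= => /andP[_ uB].
  by rewrite ler_wpM2r ?df_ge0// flat_tail_nonincreasing// ltW.
rewrite ge0_integralZl_real ?tail_ge0//; last by move=> u; exact: df_ge0.
have -> : \int[mu]_(u in `[z, (z + B)%R[) (F (z - u))%:E =
    \int[mu]_(u in `[0%R, B[) (F (0 - u))%:E.
  have -> : `[z, (z + B)%R[%classic = (fun u : R => z - u)%R @^-1` `](- B)%R, 0%R].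
    by apply/seteqP; split => u /=; rewrite !in_itv/=; lra.
  have -> : `[0%R, B[%classic = (fun u : R => 0 - u)%R @^-1` `](- B)%R, 0%R].
    by apply/seteqP; split => u /=; rewrite !in_itv/=; lra.
  by rewrite !(@ge0_integral_reflect R _ _ F)//; exact: df_ge0.
apply: (@le_trans _ _ ((flat_tail N (z + B))%:E * k'%:E)).
  by rewrite -EFinM lee_fin (le_trans step)// mulrC.
by apply: lee_wpmul2l; [rewrite lee_fin tail_ge0|exact: ltW].
Unshelve. all: by end_near. Qed.

(** The length of the flat stretch on which the flattened tail has mass b. *)
Definition barrier (b N : R) : R := (b / Fb N)%R.

Definition potential (b N y : R) : \bar R :=
  \int[mu]_(u in `[(- barrier b N)%R, +oo[) (flat_tail N u * (y < u)%R%:R)%:E.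

Definition integrated_tail (x : R) : R :=
  fine (\int[mu]_(u in `]x, +oo[) (Fb u)%:E).

Lemma integrated_tailE (x : R) : (0 <= x)%R ->
  \int[mu]_(u in `]x, +oo[) (Fb u)%:E = (integrated_tail x)%:E.
Proof.
move=> x0; have mF := measurable_tail.
rewrite /integrated_tail fineK// ge0_fin_numE; last first.
  by apply: integral_ge0 => u _; rewrite lee_fin tail_ge0.
apply: (@le_lt_trans _ _ tail_mass%:E); last exact: ltry.
rewrite -tail_massE; apply: ge0_subset_integral_real => //; first exact: tail_ge0.
by apply: subset_itvr; rewrite bnd_simp.
Qed.

Lemma integrated_tail_ge0 (x : R) : (0 <= integrated_tail x)%R.
Proof. by apply: fine_ge0; apply: integral_ge0 => u _; rewrite lee_fin tail_ge0. Qed.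

Lemma integrated_tail_shift (x s : R) : (0 <= x)%R -> (0 <= s)%R ->
  (integrated_tail x <= s * Fb x + integrated_tail (x + s))%R.
Proof.
move=> x0 s0; have mF := measurable_tail.
rewrite -lee_fin EFinD -!integrated_tailE ?addr_ge0//.
rewrite (@ge0_integral_itv_split R (BRight x) (BRight (x + s)%R) +oo%O)//; last 2 first.
- by rewrite bnd_simp lerDl.
- exact: tail_ge0.
rewrite leeD2r//.
apply: le_trans (@ge0_integral_itv_le R x (x + s)%R (Fb x) false false _ _ _ _ _ _) _ => //.
- by rewrite lerDl.
- exact: tail_ge0.
- exact: tail_ge0.
- by move=> u xu _; exact: tail_nonincreasing.
- by rewrite lee_fin (addrC x) addrK mulrC.
Qed.

Lemma integrated_tail_near0 (e : R) : (0 < e)%R ->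
  \forall x \near +oo%R, (integrated_tail x < e)%R.
Proof.
move=> e0; have mF := measurable_tail.
have kA : (tail_mass - e)%:E < \int[mu]_(y in `[0%R, +oo[) (Fb y)%:E.
  by rewrite tail_massE lte_fin; lra.
have H := ge0_cvg_integral_itvy mF tail_ge0 kA.
near=> x.
have hx : (tail_mass - e)%:E < \int[mu]_(y in `[0%R, x[) (Fb y)%:E by near: x.
have x0 : (0 <= x)%R by near: x; apply: nbhs_pinfty_ge; exact: num_real.
have := tail_massE.
rewrite (@ge0_integral_itv_split R (BLeft 0%R) (BRight x) +oo%O)//; last first.
  exact: tail_ge0.
rewrite integrated_tailE//.
have : \int[mu]_(y in `[0%R, x[) (Fb y)%:E <= \int[mu]_(y in `[0%R, x]) (Fb y)%:E.
  apply: ge0_subset_integral_real => //; first exact: tail_ge0.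
  by apply: subset_itvl; rewrite bnd_simp.
move=> /(lt_le_trans hx); case: integral => [r| |]//=.
by rewrite lte_fin -EFinD => rx [] /eqP; lra.
Unshelve. all: by end_near. Qed.

Lemma measurable_potential_integrand (N y : R) :
  measurable_fun setT (fun u => flat_tail N u * (y < u)%R%:R : R)%R.
Proof.
apply: measurable_funM; first exact: measurable_flat_tail.
rewrite [X in measurable_fun _ X](_ : _ = \1_`]y, +oo[).
  exact: measurable_indic.
by apply/funext => u; rewrite indicE mem_setE in_itv/= andbT.
Qed.

Lemma potential_ge0 (b N y : R) : 0 <= potential b N y.
Proof. by apply: integral_ge0 => u _; rewrite lee_fin mulr_ge0// tail_ge0. Qed.

Lemma potential_inside (b N y : R) : (- barrier b N <= y)%R ->
  potential b N y = \int[mu]_(u in `]y, +oo[) (flat_tail N u)%:E.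
Proof.
move=> Ly; rewrite /potential.
rewrite (@ge0_integral_itv_split R (BLeft (- barrier b N)%R) (BRight y) +oo%O)//; last 2 first.
- exact: measurable_potential_integrand.
- by move=> u; rewrite mulr_ge0// tail_ge0.
rewrite integral0_eq ?add0e; last first.
  by move=> u /=; rewrite in_itv/= => /andP[_ uy]; rewrite ltNge uy mulr0.
by apply: eq_integral => u; rewrite inE/= in_itv/= andbT => ->; rewrite mulr1.
Qed.

Lemma potential_beyond (b N y : R) : (0 <= b)%R -> (0 <= N)%R ->
  (y < - barrier b N)%R -> b%:E <= potential b N y.
Proof.
move=> b0 N0 yL; have FN := tail_gt0 N.
have L0 : (0 <= barrier b N)%R by rewrite divr_ge0// ltW.
have bE : b = (Fb N * (0 - - barrier b N))%R.
  by rewrite sub0r opprK /barrier mulrCA divff ?mulr1 ?gt_eqF.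
apply: (@le_trans _ _ (\int[mu]_(u in `[(- barrier b N)%R, 0%R[)
    (flat_tail N u * (y < u)%R%:R)%:E)); last first.
  apply: ge0_subset_integral_real => //.
  - exact: measurable_potential_integrand.
  - by move=> u; rewrite mulr_ge0// tail_ge0.
  - by apply: subset_itvl; rewrite bnd_simp.
rewrite [in X in X <= _]bE; apply: ge0_integral_itv_ge.
- by rewrite oppr_le0.
- exact: ltW.
- exact: measurable_potential_integrand.
- by move=> u; rewrite mulr_ge0// tail_ge0.
- by move=> u Lu u0; rewrite (lt_le_trans yL Lu) mulr1 flat_tail_low// (le_trans u0).
Qed.

Lemma potential_far (b N y : R) : (0 <= b)%R -> (0 <= N)%R -> (N <= y)%R ->
  potential b N y = (integrated_tail y)%:E.
Proof.
move=> b0 N0 Ny; rewrite potential_inside; last first.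
  by rewrite (@le_trans _ _ 0%R) ?(le_trans N0)// oppr_le0 divr_ge0// tail_ge0.
rewrite -integrated_tailE ?(le_trans N0)//; apply: eq_integral => u.
rewrite inE/= in_itv/= andbT => yu; rewrite flat_tail_high//.
by rewrite (le_trans Ny) ?ltW.
Qed.

(** The left-hand side is the mean of the potential after a step from z, as given
    by [integral_potential]. *)
Definition potential_superharmonic (b N : R) : Prop :=
  forall z : R, (- barrier b N <= z)%R ->
    \int[mu]_(u in `[(- barrier b N)%R, +oo[) (flat_tail N u * Fb (z - u))%:E
      <= potential b N z.

(** Since F + Fb = 1, the integrals over [z, +oo[ on the two sides differ by the
    downward loss, which has to dominate the upward gain. Any rate k between
    [tail_mass + b] and [tail_mass + a] separates them. *)
Lemma near_potential_superharmonic (a b : R) : (0 <= b)%R -> (b < a)%R ->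
  \int[mu]_(u in `]-oo, 0%R[) (F u)%:E = (tail_mass + a)%:E ->
  \forall N \near +oo%R, potential_superharmonic b N.
Proof.
move=> b0 ba neg; have A0 := tail_mass_gt0.
pose k := (tail_mass + (a + b) / 2)%R.
near=> N => z Lz.
have up : \int[mu]_(u in `[(- barrier b N)%R, z[) (flat_tail N u * Fb (z - u))%:E
      <= (k * flat_tail N z)%:E.
  move: z Lz; near: N; apply: upward_drift_le => //; rewrite /k; lra.
have down : (k * flat_tail N z)%:E <=
    \int[mu]_(u in `[z, +oo[) (flat_tail N u * F (z - u))%:E.
  move: {up Lz} z; near: N.
  by apply: (@downward_drift_ge (tail_mass + a)%R) => //; rewrite /k; lra.
have mf := measurable_flat_tail N.
have mr : measurable_fun setT (fun u : R => F (z - u)%R).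
  by apply: measurable_reflect; exact: measurable_df.
have mrt : measurable_fun setT (fun u : R => Fb (z - u)%R).
  by apply: measurable_reflect; exact: measurable_tail.
have mg : measurable_fun setT (fun u => flat_tail N u * Fb (z - u) : R)%R.
  exact: measurable_funM.
have mh : measurable_fun setT (fun u => flat_tail N u * F (z - u) : R)%R.
  exact: measurable_funM.
have g0 u : (0 <= flat_tail N u * Fb (z - u))%R by rewrite mulr_ge0// tail_ge0.
have h0 u : (0 <= flat_tail N u * F (z - u))%R.
  by rewrite mulr_ge0// ?tail_ge0 ?df_ge0.
rewrite (@ge0_integral_itv_split R (BLeft (- barrier b N)%R) (BLeft z) +oo%O)//.
rewrite potential_inside//.
rewrite integral_itv_obnd_cbnd; last first.
  by apply/measurable_funTS/measurable_EFinP.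
apply: (@le_trans _ _ (\int[mu]_(u in `[z, +oo[) (flat_tail N u * F (z - u))%:E +
   \int[mu]_(u in `[z, +oo[) (flat_tail N u * Fb (z - u))%:E)).
  by rewrite leeD2r// (le_trans up).
rewrite -ge0_integralD//.
- under eq_integral do rewrite -EFinD -mulrDr /tail addrC subrK mulr1.
  by [].
- by move=> u _; rewrite lee_fin.
- exact/measurable_funTS/measurable_EFinP.
- by move=> u _; rewrite lee_fin.
- exact/measurable_funTS/measurable_EFinP.
Unshelve. all: by end_near. Qed.

End subexponential.
End tail_of_a_distribution_function.

(** * Independence of the past *)
Section past_of_an_independent_sequence.
Context {R : realType} d {T : measurableType d} (P : probability T R)
  (xi : nat -> {RV P >-> R}).
Implicit Types (J : {fset nat}) (k : nat).

(** A pi-system generating the sigma-algebra of the variables of index in J. *)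
Definition rectangles J : set (set T) :=
  [set E | exists2 A : nat -> set R, (forall i, measurable (A i)) &
     E = \bigcap_(i in [set` J]) (xi i @^-1` A i)].

(** The sample space itself, with that coarser sigma-algebra. *)
Definition past J := g_sigma_algebraType (rectangles J).

Lemma measurable_RV_preimage k (B : set R) : measurable B ->
  measurable (xi k @^-1` B).
Proof. by move=> mB; rewrite -[X in measurable X]setTI; exact: measurable_funP. Qed.

Lemma rectangles_measurable J : rectangles J `<=` measurable.
Proof.
move=> _ [A mA ->]; apply: fin_bigcap_measurable; first exact: finite_fset.
by move=> i _; exact: measurable_RV_preimage.
Qed.

Lemma past_measurable J E : <<s rectangles J >> E -> measurable E.
Proof.
apply: smallest_sub; last exact: rectangles_measurable.
exact: sigma_algebra_measurable.
Qed.

Lemma setI_closed_rectangles J : setI_closed (rectangles J).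
Proof.
move=> _ _ [A mA ->] [B mB ->]; exists (fun i => A i `&` B i).
  by move=> i; exact: measurableI.
by rewrite -bigcapI; apply: eq_bigcapr => i _; rewrite preimage_setI.
Qed.

Lemma rectangles_setT J : rectangles J setT.
Proof.
exists (fun=> setT) => //; apply/esym/seteqP; split => // w _ i _ //.
Qed.

Lemma measurable_xi_past J k : k \in J ->
  measurable_fun setT (xi k : past J -> R).
Proof.
move=> kJ _ B mB; rewrite setTI; apply: sub_sigma_algebra.
exists (fun i => if i == k then B else setT).
  by move=> i; case: ifP.
apply/seteqP; split => [w wB i _ /=|w /(_ k kJ)/=]; last by rewrite eqxx.
by case: eqP => // ->.
Qed.

Hypothesis indep : mutually_independent xi.

(** As functions of E, both sides are finite measures, and they agree on the
    pi-system of rectangles. *)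
Lemma past_indep J k E (B : set R) : k \notin J -> measurable B ->
  <<s rectangles J >> E ->
  P (E `&` xi k @^-1` B) = P E * P (xi k @^-1` B).
Proof.
move=> kJ mB JE; have mkB := measurable_RV_preimage k mB.
have c0 : (0 <= fine (P (xi k @^-1` B)))%R by exact: fine_ge0.
pose m1 : {measure set T -> \bar R} := mrestr P mkB.
pose m2 : {measure set T -> \bar R} := mscale (NngNum c0) P.
have m2E A : m2 A = P A * P (xi k @^-1` B).
  by rewrite /m2/= /mscale/= fineK ?fin_num_measure// muleC.
rewrite -m2E.
apply: (@g_sigma_algebra_measure_unique _ R T (rectangles J) _
  (fun=> setT) _ _ m1 m2) => //.
- exact: rectangles_measurable.
- by move=> _; exact: rectangles_setT.
- by apply/seteqP; split => // w _; exists 0%N.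
- exact: setI_closed_rectangles.
- move=> _ [A mA ->]; rewrite m2E /m1/= /mrestr.
  pose A' i := if i == k then B else A i.
  have mA' i : i \in (k |` J)%fset -> measurable (A' i).
    by move=> _; rewrite /A'; case: ifP.
  have -> : \bigcap_(i in [set` J]) xi i @^-1` A i `&` xi k @^-1` B =
      \bigcap_(i in [set` (k |` J)%fset]) xi i @^-1` A' i.
    apply/seteqP; split => [w [wA wB] i /=|w wA].
      rewrite in_fset1U /A' => /orP[/eqP ->|iJ]; first by rewrite eqxx.
      by case: eqP => [->//|_]; exact: wA.
    split => [i /= iJ|].
      have := wA i; rewrite /= in_fset1U iJ orbT /A' => /(_ isT).
      by case: eqP => // ik; rewrite -ik iJ in kJ.
    by have := wA k; rewrite /= in_fset1U eqxx /A' eqxx => /(_ isT).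
  rewrite (indep mA') big_fsetU1//= muleC /A' eqxx; congr (_ * _).
  rewrite (@indep J A)//; apply: eq_big_seq => i iJ.
  by case: eqP => // ik; rewrite -ik iJ in kJ.
- move=> _; rewrite /m1/= /mrestr setTI.
  by rewrite (le_lt_trans (probability_le1 _ _))// ltry.
Qed.

(** The outcome, as a random element of [past J], is independent of xi k. Their
    joint law is therefore a product, and Tonelli's theorem applies. *)
Lemma past_freeze J k (f : past J * R -> \bar R) : k \notin J ->
  measurable_fun setT f -> (forall x, 0 <= f x) ->
  \int[P]_w f (w, xi k w) =
  \int[P]_w \int[distribution P (xi k)]_t f (w, t).
Proof.
move=> kJ mf f0.
have mid : measurable_fun setT (id : T -> past J).
  by move=> _ B mB; rewrite setTI; exact: past_measurable mB.
pose X : {mfun T >-> past J} := HB.pack (id : T -> past J)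
  (isMeasurableFun.Build _ _ _ _ _ mid).
have mpair : measurable_fun setT (fun w : T => (w : past J, xi k w)).
  by apply/measurable_fun_pairP; split; [exact: mid|exact: measurable_funP].
pose Z : {mfun T >-> (past J * R)%type} := HB.pack (fun w : T => (w : past J, xi k w))
  (isMeasurableFun.Build _ _ _ _ _ mpair).
transitivity (\int[distribution P Z]_z f z).
  by rewrite ge0_integral_distribution.
transitivity (\int[distribution P X \x distribution P (xi k)]_z f z).
  apply: eq_measure_integral => A mA _; apply/esym.
  apply: product_measure_unique => // B C mB mC.
  exact: (@past_indep J k B C).
rewrite fubini_tonelli1// ge0_integral_distribution//.
- exact: measurable_fun_fubini_tonelli_F.
- by move=> y; apply: integral_ge0.
Qed.

End past_of_an_independent_sequence.

(** * The random walk killed outside a set *)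
Section random_walk.
Context {R : realType} d {T : measurableType d} (P : probability T R)
  (xi : nat -> {RV P >-> R}).
Notation S := (partial_sum xi).

Definition steps (n : nat) : {fset nat} := [fset i in iota 1 n]%fset.

Lemma in_steps n i : (i \in steps n) = (1 <= i <= n)%N.
Proof. by rewrite in_fset mem_iota add1n ltnS. Qed.

Lemma next_notin_steps n : n.+1 \notin steps n.
Proof. by rewrite in_steps ltnn andbF. Qed.

Lemma walk0 (w : T) : S 0%N w = 0%R.
Proof. by rewrite /partial_sum big_geq. Qed.

Lemma walkS n (w : T) : S n.+1 w = (S n w + xi n.+1 w)%R.
Proof. by rewrite /partial_sum big_nat_recr. Qed.

Lemma measurable_walk_past n k : (k <= n)%N ->
  measurable_fun setT (S k : past xi (steps n) -> R).
Proof.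
elim: k => [|k IH] kn.
  rewrite (_ : S 0%N = cst 0%R); first exact: measurable_cst.
  by apply/funext => w; rewrite walk0.
rewrite (_ : S k.+1 = (fun w => S k w + xi k.+1 w)%R).
  apply: measurable_funD; first exact: IH (ltnW kn).
  by apply: measurable_xi_past; rewrite in_steps.
by apply/funext => w; rewrite walkS.
Qed.

(** The constraint starts at time 1: the origin need not belong to D. *)
Definition stay (D : set R) (n : nat) : set T :=
  [set w | forall k, (1 <= k <= n)%N -> D (S k w)].

Definition leave (D : set R) (n : nat) : set T :=
  stay D n `&` S n.+1 @^-1` (~` D).

Lemma stay0 D : stay D 0 = setT.
Proof. by apply/seteqP; split => // w _ [|k]. Qed.

Lemma stayS D n : stay D n.+1 = stay D n `&` S n.+1 @^-1` D.
Proof.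
apply/seteqP; split => [w Dw|w [Dw Dn] k /andP[k1]].
  split=> [k /andP[k1 kn]|]; last by apply: Dw; rewrite leqnn.
  by apply: Dw; rewrite k1 ltnW.
rewrite leq_eqVlt => /orP[/eqP -> //|kn].
by apply: Dw; rewrite k1 -ltnS.
Qed.

Lemma stay_nonincreasing D m n : (m <= n)%N -> stay D n `<=` stay D m.
Proof.
move=> mn w Dw k /andP[k1 km]; apply: Dw; by rewrite k1 (leq_trans km).
Qed.

Lemma stay_past D n : measurable D -> <<s rectangles xi (steps n) >> (stay D n).
Proof.
move=> mD.
have -> : stay D n =
    \bigcap_k (if (1 <= k <= n)%N then S k @^-1` D else setT).
  apply/seteqP; split => [w Dw k _|w Dw k kn].
    by case: ifPn => // kn; exact: Dw.
  by have := Dw k I; rewrite kn.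
apply: (@bigcapT_measurable _ (past xi (steps n))) => k.
case: ifPn => // /andP[_ kn].
rewrite -[X in measurable X]setTI.
exact: (measurable_walk_past kn).
Qed.

Lemma measurable_stay D n : measurable D -> measurable (stay D n).
Proof. by move=> mD; exact: (past_measurable (@stay_past D n mD)). Qed.

Lemma measurable_walk n : measurable_fun setT (S n : T -> R).
Proof.
move=> _ B mB; rewrite setTI; apply: (@past_measurable _ _ _ _ xi (steps n)).
by rewrite -[X in <<s _>> X]setTI; exact: (measurable_walk_past (leqnn n)).
Qed.

Lemma measurable_leave D n : measurable D -> measurable (leave D n).
Proof.
move=> mD; apply: measurableI; first exact: measurable_stay.
rewrite -[X in measurable X]setTI; apply: measurable_walk => //.
exact: measurableC.
Qed.

Lemma trivIset_leave D : trivIset setT (leave D).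
Proof.
apply/trivIsetP => i j _ _; rewrite neq_ltn => /orP[] ij; apply/seteqP; split => // w.
  by case=> -[_ nD] [st _]; apply: nD; apply: st; rewrite /= ij.
by case=> -[st _] [_ nD]; apply: nD; apply: st; rewrite /= ij.
Qed.

Lemma stay_leaveU D n : stay D n = stay D n.+1 `|` leave D n.
Proof. by rewrite stayS /leave preimage_setC -setIUr setUv setIT. Qed.

Lemma stay_leaveI D n : [disjoint stay D n.+1 & leave D n].
Proof.
apply/disj_setPS => w [+ [_ nD]]; rewrite stayS => -[_ /=]; exact: nD.
Qed.

Lemma probability_stay_split D n : measurable D ->
  P (stay D n) = P (stay D n.+1) + P (leave D n).
Proof.
move=> mD; rewrite stay_leaveU measureU//.
- exact: measurable_stay.
- exact: measurable_leave.
- exact/disj_set2P/stay_leaveI.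
Qed.

Lemma probability_leave_sum D n : measurable D ->
  \sum_(0 <= k < n) P (leave D k) + P (stay D n) = 1.
Proof.
move=> mD; elim: n => [|n IH].
  by rewrite big_geq// add0e stay0 probability_setT.
by rewrite big_nat_recr//= -IH -addeA (addeC (P (leave D n))) -probability_stay_split.
Qed.

Lemma walk_in_domain D n w : stay D n w -> S n w = 0%R \/ D (S n w).
Proof.
case: n => [|n] Dw; first by left; exact: walk0.
by right; apply: Dw; rewrite leqnn.
Qed.

Hypothesis indep : mutually_independent xi.
Hypothesis same_law : forall n (A : set R), measurable A ->
  distribution P (xi n) A = distribution P (xi 0%N) A.
Notation law := (distribution P (xi 0%N)).

Lemma freeze_next n E (f : past xi (steps n) * R -> \bar R) :
  <<s rectangles xi (steps n) >> E ->
  measurable_fun setT f -> (forall x, 0 <= f x) ->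
  \int[P]_(w in E) f (w, xi n.+1 w) =
  \int[P]_(w in E) \int[law]_t f (w, t).
Proof.
move=> pE mf f0.
pose g (z : past xi (steps n) * R) := f z * (\1_E z.1)%:E.
have mg : measurable_fun setT g.
  apply: emeasurable_funM => //; apply/measurable_EFinP.
  by apply: measurableT_comp => //; exact: measurable_indic.
have g0 z : 0 <= g z by rewrite mule_ge0.
rewrite integral_mkcond epatch_indic.
have := @past_freeze R d T P xi indep (steps n) n.+1 g (next_notin_steps n) mg g0.
rewrite /g /= => ->; rewrite [RHS]integral_mkcond epatch_indic.
apply: eq_integral => w _.
rewrite (eq_measure_integral law); last first.
  by move=> A mA _; exact: same_law.
rewrite ge0_integralZr//.
exact: (measurableT_comp mf (pair1_measurable _)).
Qed.

Lemma walk_step n E (V : R -> \bar R) : <<s rectangles xi (steps n) >> E ->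
  measurable_fun setT V -> (forall x, 0 <= V x) ->
  \int[P]_(w in E) V (S n.+1 w) =
  \int[P]_(w in E) \int[law]_t V (S n w + t)%R.
Proof.
move=> pE mV V0; under eq_integral do rewrite walkS.
apply: (freeze_next (f := fun z => V (S n z.1 + z.2)%R) pE) => //.
apply: (measurableT_comp mV); apply: measurable_funD => //.
apply: (measurableT_comp (measurable_walk_past (leqnn n))).
exact: measurable_fst.
Qed.

Lemma next_step n E (g : R -> \bar R) : <<s rectangles xi (steps n) >> E ->
  measurable_fun setT g -> (forall x, 0 <= g x) ->
  \int[P]_(w in E) g (xi n.+1 w) = P E * \int[law]_t g t.
Proof.
move=> pE mg g0.
rewrite (freeze_next (f := fun z => g z.2) pE)//; last first.
  exact: (measurableT_comp mg).
transitivity (\int[P]_(w in E) cst (\int[law]_t g t) w); first by [].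
by rewrite integral_cst; [rewrite muleC|exact: past_measurable pE].
Qed.

(** Foster-Lyapunov criterion. By the drift condition, the mean of V (S n) on
    [stay D n] decreases at each step by at least eta times the probability of
    [stay D n] and by the mean of V at the exit. These losses telescope, and their
    total is bounded by the initial value. *)
Lemma foster (D : set R) (V : R -> \bar R) (eta : R) : measurable D ->
  measurable_fun setT V -> (forall x, 0 <= V x) -> (0 <= eta)%R ->
  (forall y, y = 0%R \/ D y -> \int[law]_t V (y + t)%R + eta%:E <= V y) ->
  \sum_(n <oo) (eta%:E * P (stay D n) + \int[P]_(w in leave D n) V (S n.+1 w))
    <= V 0%R.
Proof.
move=> mD mV V0 eta0 drift.
have mVS n : measurable_fun setT (fun w : T => V (S n w)).
  by apply: (measurableT_comp mV); exact: measurable_walk.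
have mI n : measurable_fun setT (fun w : T => \int[law]_t V (S n w + t)%R).
  apply: (measurable_fun_fubini_tonelli_F
    (fun z : T * R => V (S n z.1 + z.2)%R)) => //.
  apply: (measurableT_comp mV); apply: measurable_funD => //.
  by apply: (measurableT_comp (measurable_walk n)); exact: measurable_fst.
have t0 n : 0 <= eta%:E * P (stay D n) + \int[P]_(w in leave D n) V (S n.+1 w).
  by rewrite adde_ge0 ?mule_ge0 ?integral_ge0.
have key n : \sum_(0 <= k < n)
    (eta%:E * P (stay D k) + \int[P]_(w in leave D k) V (S k.+1 w)) +
    \int[P]_(w in stay D n) V (S n w) <= V 0%R.
  elim: n => [|n IH].
    rewrite big_geq// add0e stay0.
    under eq_integral do rewrite walk0.
    have -> : \int[P]_(w in setT) V 0%R = V 0%R * P setT by exact: integral_cst.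
    by rewrite probability_setT mule1.
  apply: le_trans IH; rewrite big_nat_recr//= -addeA leeD2l//.
  rewrite -addeA (addeC (\int[P]_(w in leave D n) _)).
  rewrite -ge0_integral_setU//; last 4 first.
  - exact: measurable_stay.
  - exact: measurable_leave.
  - exact: measurable_funTS.
  - exact: stay_leaveI.
  rewrite -stay_leaveU walk_step//; last exact: stay_past.
  have -> : eta%:E * P (stay D n) = \int[P]_(w in stay D n) eta%:E.
    by apply/esym/integral_cst; exact: measurable_stay.
  rewrite -ge0_integralD//; last 3 first.
  - exact: measurable_stay.
  - by move=> w _; exact: integral_ge0.
  - exact: measurable_funTS.
  apply: ge0_le_integral => //.
  - exact: measurable_stay.
  - by move=> w _; rewrite adde_ge0 ?integral_ge0.
  - by apply: measurable_funTS; exact: emeasurable_funD.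
  - exact: measurable_funTS.
  - by move=> w /walk_in_domain Dw; rewrite addeC; exact: drift.
apply: lime_le; first by apply: is_cvg_nneseries => n _ _; exact: t0.
apply: nearW => n; apply: le_trans (key n).
by rewrite leeDl ?integral_ge0.
Qed.

End random_walk.

(** * Hitting time and cycle maximum through exit events *)

Lemma ge_all_nat_eq_pinfty {R : realType} (x : \bar R) :
  (forall n : nat, n%:R%:E <= x) -> x = +oo.
Proof.
case: x => [r| |] // h; last by have := h 0%N.
have := h (Num.truncn r).+1; rewrite lee_fin => /(lt_le_trans (truncnS_gt r)).
by rewrite ltxx.
Qed.

Lemma nneseries_indic_prefix {R : realType} {T : Type} (A : nat -> set T)
    (w : T) (m : nat) :
  (forall k, A k w <-> (k < m)%N) ->
  \sum_(k <oo) (\1_(A k) w)%:E = (m%:R%:E : \bar R).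
Proof.
move=> Am; rewrite (@nneseries_split _ _ 0 m)//.
rewrite add0n eseries0 ?adde0; last first.
  move=> k mk _; rewrite indicE memNset// => /Am; by rewrite ltnNge mk.
rewrite big_mkord (eq_bigr (fun=> 1)); last first.
  by move=> k _; rewrite indicE mem_set//; apply/Am.
by rewrite sumEFin sumr_const card_ord.
Qed.

Section excursion.
Context {R : realType} d {T : measurableType d} (P : probability T R)
  (xi : nat -> {RV P >-> R}).
Notation S := (partial_sum xi).
Notation alive := (stay xi `]0%R, +oo[).
Notation confined x := (stay xi `]0%R, x]).

Lemma aliveP n w : alive n w <-> forall k, (1 <= k <= n)%N -> (0 < S k w)%R.
Proof.
by split=> h k kn; have := h k kn; rewrite /= in_itv/= andbT.
Qed.

Lemma lt_hitting_time n w : n%:R%:E < hitting_time xi w <-> alive n w.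
Proof.
rewrite aliveP; split => [nt k /andP[k1 kn]|h].
  rewrite ltNge; apply/negP => Sk.
  have : hitting_time xi w <= k%:R%:E.
    by apply: ereal_inf_lbound; exists k.
  by move=> /(lt_le_trans nt); rewrite lte_fin ltr_nat ltnNge kn.
apply: (@lt_le_trans _ _ n.+1%:R%:E); first by rewrite lte_fin ltr_nat.
apply: le_ereal_inf_tmp => _ [k [k1 Sk] <-].
rewrite lee_fin ler_nat ltnNge; apply/negP => kn.
by have := h k; rewrite k1 kn => /(_ isT); rewrite ltNge Sk.
Qed.

(** By [lt_hitting_time], this is the tail sum of the hitting time. *)
Lemma hitting_time_series w :
  hitting_time xi w = \sum_(n <oo) (\1_(alive n) w)%:E.
Proof.
have [dead|imm] := pselect (exists n, ~ alive n w).
  have ex : exists n, `[< ~ alive n w >] by case: dead => n nn; exists n; apply/asboolP.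
  case: (ex_minnP ex) => m /asboolP mdead mmin.
  have aliveE k : alive k w <-> (k < m)%N.
    split=> [ak|km].
      rewrite ltnNge; apply/negP => mk; apply: mdead.
      exact: stay_nonincreasing mk _ ak.
    apply: contrapT => nk; have := mmin k; rewrite leqNgt km => /(_ _)/negP; apply.
      by apply/asboolP.
    by [].
  rewrite (nneseries_indic_prefix aliveE).
  case: m mdead mmin aliveE => [|m] mdead mmin aliveE.
    by exfalso; apply: mdead; rewrite stay0.
  apply/eqP; rewrite eq_le; apply/andP; split.
    apply: ereal_inf_lbound; exists m.+1 => //; split => //.
    rewrite leNgt; apply/negP => Sm; apply: mdead.
    by rewrite stayS; split; [apply/aliveE|rewrite /= in_itv/= Sm].
  apply: le_ereal_inf_tmp => _ [k [k1 Sk] <-].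
  rewrite lee_fin ler_nat ltnNge; apply/negP => km.
  have /aliveP/(_ k) : alive m w by apply/aliveE.
  by rewrite k1 km => /(_ isT); rewrite ltNge Sk.
have al n : alive n w by apply: contrapT => nn; apply: imm; exists n.
rewrite (@ge_all_nat_eq_pinfty _ (hitting_time xi w)); last first.
  by move=> n; apply/ltW/lt_hitting_time.
rewrite (@ge_all_nat_eq_pinfty _ (\sum_(n <oo) _))// => n.
rewrite (_ : n%:R%:E = \sum_(0 <= k < n) (\1_(alive k) w)%:E).
  by apply: nneseries_lim_ge => k _ _; rewrite lee_fin.
rewrite (eq_bigr (fun=> 1)); last by move=> k _; rewrite indicE mem_set.
by rewrite sumEFin sumr_const_nat subn0.
Qed.

Lemma expected_hitting_time :
  \int[P]_w hitting_time xi w = \sum_(n <oo) P (alive n).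
Proof.
under eq_integral do rewrite hitting_time_series.
rewrite integral_nneseries//.
- apply: eq_eseriesr => n _; rewrite integral_indic ?setIT//.
  exact: measurable_stay.
- by move=> n; apply/measurable_EFinP/measurable_indic/measurable_stay.
Qed.

Definition exit_up (x : R) (n : nat) : set T :=
  confined x n `&` S n.+1 @^-1` `]x, +oo[.

Definition exit_down (x : R) (n : nat) : set T :=
  confined x n `&` S n.+1 @^-1` `]-oo, 0%R].

Lemma measurable_walk_preimage n (B : set R) : measurable B ->
  measurable (S n @^-1` B).
Proof.
by move=> mB; rewrite -[X in measurable X]setTI; exact: measurable_walk.
Qed.

Lemma measurable_exit_up x n : measurable (exit_up x n).
Proof.
by apply: measurableI; [exact: measurable_stay|exact: measurable_walk_preimage].
Qed.

Lemma measurable_exit_down x n : measurable (exit_down x n).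
Proof.
by apply: measurableI; [exact: measurable_stay|exact: measurable_walk_preimage].
Qed.

Lemma leave_exits x n : (0 <= x)%R ->
  leave xi `]0%R, x] n = exit_up x n `|` exit_down x n.
Proof.
move=> x0; rewrite /leave /exit_up /exit_down -setIUr -preimage_setU.
congr (_ `&` _ @^-1` _); apply/seteqP; split => y /=; rewrite !in_itv/= ?andbT.
  by move=> /negP; rewrite negb_and -!ltNge -leNgt => /orP[]; tauto.
move=> [xy|y0]; apply/negP; rewrite negb_and -leNgt -ltNge.
  by rewrite xy orbT.
by rewrite y0.
Qed.

Lemma exits_disjoint x n : (0 <= x)%R -> exit_up x n `&` exit_down x n = set0.
Proof.
move=> x0; apply/seteqP; split => // w [[_ /=]].
rewrite in_itv/= andbT => xS [_ /=]; rewrite in_itv/= => S0.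
by have := lt_le_trans (le_lt_trans x0 xS) S0; rewrite ltxx.
Qed.

Lemma exit_up_sub_leave x n : (0 <= x)%R -> exit_up x n `<=` leave xi `]0%R, x] n.
Proof. by move=> x0; rewrite leave_exits//; left. Qed.

Lemma trivIset_sub_leave D (E : nat -> set T) :
  (forall n, E n `<=` leave xi D n) -> trivIset setT E.
Proof.
move=> EL; apply/trivIsetP => i j _ _ ij; apply/seteqP; split => // w [Ei Ej].
have /trivIsetP/(_ i j I I ij) := @trivIset_leave R d T P xi D.
by move=> /seteqP[+ _] => /(_ w); apply; split; exact: EL.
Qed.

Lemma trivIset_exit_up x : (0 <= x)%R -> trivIset setT (exit_up x).
Proof. by move=> x0; apply: trivIset_sub_leave => n; exact: exit_up_sub_leave. Qed.

Lemma confined_alive x n : confined x n `<=` alive n.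
Proof.
move=> w h k kn; have := h k kn; by rewrite /= !in_itv/= andbT => /andP[].
Qed.

(** The exit is the first passage above x: until then the walk is at most x, and
    it is positive because the passage precedes the hitting time. *)
Lemma lt_cycle_max x w : (0 <= x)%R ->
  x%:E < cycle_max xi w <-> exists n, exit_up x n w.
Proof.
move=> x0; split => [|[n [Cn /=]]].
  rewrite /cycle_max => /ereal_sup_gt[_ [n /lt_hitting_time an <-]].
  rewrite lte_fin => xS.
  have ex : exists n, (x < S n w)%R by exists n.
  case: (ex_minnP ex) => -[|m] xm mmin.
    by move: xm; rewrite walk0 ltNge x0.
  exists m; split; last by rewrite /= in_itv/= xm.
  move=> k /andP[k1 km] /=; rewrite in_itv/=; apply/andP; split.
    have /aliveP := an; apply; rewrite k1 /=.
    by rewrite (leq_trans km)// (leq_trans _ (mmin n xS)).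
  rewrite leNgt; apply/negP => /mmin; by rewrite leqNgt ltnS km.
rewrite in_itv/= andbT => xS.
apply: (@lt_le_trans _ _ (S n.+1 w)%:E); first by rewrite lte_fin.
apply: ereal_sup_ubound; exists n.+1 => //.
apply/lt_hitting_time; rewrite stayS; split; first exact: confined_alive Cn.
by rewrite /= in_itv/= andbT (le_lt_trans x0).
Qed.

Lemma cycle_max_gtE x : (0 <= x)%R ->
  [set w | x%:E < cycle_max xi w] = \bigcup_n exit_up x n.
Proof.
move=> x0; apply/seteqP; split => w /=.
  by move=> /(lt_cycle_max _ x0)[n h]; exists n.
by case=> n _ h; apply/(lt_cycle_max _ x0); exists n.
Qed.

Lemma measurable_cycle_max_gt x : (0 <= x)%R ->
  measurable [set w | x%:E < cycle_max xi w].
Proof.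
move=> x0; rewrite cycle_max_gtE//.
by apply: bigcup_measurable => n _; exact: measurable_exit_up.
Qed.

Lemma probability_cycle_max x : (0 <= x)%R ->
  P [set w | x%:E < cycle_max xi w] = \sum_(n <oo) P (exit_up x n).
Proof.
move=> x0; rewrite cycle_max_gtE// measure_semi_bigcup//.
- by move=> n; exact: measurable_exit_up.
- exact: trivIset_exit_up.
- by apply: bigcup_measurable => n _; exact: measurable_exit_up.
Qed.

End excursion.

(** * Finiteness of the mean hitting time, and Wald's identity *)
Section negative_drift.
Context {R : realType} d {T : measurableType d} (P : probability T R)
  (xi : nat -> {RV P >-> R}).
Notation S := (partial_sum xi).
Notation law := (distribution P (xi 0%N)).
Notation alive := (stay xi `]0%R, +oo[).

Lemma law_of_cdf (n : nat) : (forall x, cdf (xi n) x = cdf (xi 0%N) x) ->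
  forall A, measurable A -> distribution P (xi n) A = law A.
Proof.
move=> same; apply: (@measure_unique _ R _ (@RGenOInfty.G R)
  (fun k => `](- k%:R)%R, +oo[%classic)).
- exact: RGenOInfty.measurableE.
- move=> _ _ [x ->] [y ->]; exists (Num.max x y).
  apply/seteqP; split => z /=; rewrite !in_itv/= !andbT gt_max.
    by case=> -> ->.
  by move=> /andP[].
- by move=> k; exists (- k%:R)%R.
- apply/seteqP; split => // x _; exists (Num.truncn `|x|).+1 => //=.
  rewrite in_itv/= andbT ltrNl (le_lt_trans (ler_norm _))// normrN; exact: truncnS_gt.
- move=> _ [x ->].
  have := ccdf_1_cdf (xi n) x; rewrite same -ccdf_1_cdf; exact.
- move=> k; apply: (le_lt_trans (probability_le1 _ _)); last exact: ltry.
  exact: measurable_itv.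
Qed.

Definition pos_part (t : R) : R := Num.max t 0%R.
Definition neg_part (t : R) : R := Num.max (- t)%R 0%R.

Lemma measurable_pos_part : measurable_fun setT pos_part.
Proof. exact: measurable_maxr. Qed.

Lemma measurable_neg_part : measurable_fun setT neg_part.
Proof. by apply: measurable_maxr => //; exact: oppr_measurable. Qed.

Lemma pos_part_ge0 t : (0 <= pos_part t)%R.
Proof. by rewrite le_max lexx orbT. Qed.

Lemma neg_part_ge0 t : (0 <= neg_part t)%R.
Proof. by rewrite le_max lexx orbT. Qed.

Lemma neg_part_nonincreasing (s t : R) : (s <= t)%R -> (neg_part t <= neg_part s)%R.
Proof. by move=> st; rewrite ge_max !le_max lerN2 st lexx orbT. Qed.

Lemma pos_neg_part t : t = (pos_part t - neg_part t)%R.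
Proof.
rewrite /pos_part /neg_part; have [t0|t0] := leP t 0%R.
  by rewrite max_l ?oppr_ge0// sub0r opprK.
by rewrite max_r ?subr0// oppr_le0 ltW.
Qed.

Variables (a : R).
Hypothesis xi_integrable : P.-integrable setT (EFin \o xi 0%N).
Hypothesis xi_mean : 'E_P[xi 0%N] = (- a)%:E.
Hypothesis a_gt0 : (0 < a)%R.

Definition pos_mean : R := fine (\int[law]_t (pos_part t)%:E).

Lemma integral_law (g : R -> R) : measurable_fun setT g -> (forall t, 0 <= g t)%R ->
  \int[law]_t (g t)%:E = \int[P]_w (g (xi 0%N w))%:E.
Proof.
move=> mg g0; rewrite ge0_integral_distribution//; exact/measurable_EFinP.
Qed.

Lemma mean_parts : \int[law]_t (pos_part t)%:E = pos_mean%:E /\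
  \int[law]_t (neg_part t)%:E = (pos_mean + a)%:E.
Proof.
have posE : \int[law]_t (pos_part t)%:E = \int[P]_w (EFin \o xi 0%N)^\+ w.
  rewrite integral_law; [|exact: measurable_pos_part|exact: pos_part_ge0].
  by apply: eq_integral => w _; rewrite funeposE /pos_part EFin_max.
have negE : \int[law]_t (neg_part t)%:E = \int[P]_w (EFin \o xi 0%N)^\- w.
  rewrite integral_law; [|exact: measurable_neg_part|exact: neg_part_ge0].
  by apply: eq_integral => w _; rewrite funenegE /neg_part EFin_max.
have fp : \int[law]_t (pos_part t)%:E \is a fin_num.
  by rewrite posE; exact: integrable_pos_fin_num.
have fn : \int[law]_t (neg_part t)%:E \is a fin_num.
  by rewrite negE; exact: integrable_neg_fin_num.
have := xi_mean; rewrite expectation_def.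
have -> : \int[P]_w (xi 0%N w)%:E = \int[P]_w (EFin \o xi 0%N) w by [].
rewrite integralE -posE -negE /pos_mean.
rewrite -(fineK fp) -(fineK fn) /= -EFinB => -[h]; split => //.
by congr EFin; lra.
Qed.

(** Truncating a step from below at -K changes its mean by an amount that tends to
    0 as K grows, by dominated convergence. *)
Lemma truncated_drift : exists2 K : R, (0 <= K)%R &
  \int[law]_t (neg_part (t + K))%:E <= (a / 2)%:E.
Proof.
have mr (n : nat) : measurable_fun setT (fun t : R => neg_part (t + n%:R))%R.
  by apply: (measurableT_comp measurable_neg_part); exact: measurable_funD.
pose f_ n w := (neg_part (xi 0%N w + n%:R))%:E.
have mf n : measurable_fun setT (f_ n).
  apply/measurable_EFinP; exact: (measurableT_comp (mr n)).
have cvgf w : f_ n w @[n --> \oo] --> 0.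
  apply: cvg_near_cst; near=> n.
  rewrite /f_ /neg_part max_r//.
  have : (`|xi 0%N w| <= n%:R)%R.
    near: n; exact: nbhs_infty_ger.
  by rewrite ler_norml; lra.
have domf n w : `|f_ n w| <= (neg_part (xi 0%N w))%:E.
  rewrite gee0_abs ?lee_fin ?neg_part_ge0//.
  by apply: neg_part_nonincreasing; rewrite lerDl.
have ig : P.-integrable setT (fun w => (neg_part (xi 0%N w))%:E).
  have -> : (fun w => (neg_part (xi 0%N w))%:E) = (EFin \o xi 0%N)^\-.
    by apply/funext => w; rewrite funenegE /neg_part EFin_max.
  exact: integrable_funeneg.
have [_ _ cv] := @dominated_convergence _ T R P setT measurableT f_ (cst 0) _ mf
  (measurable_cst _) (aeW _ (fun w _ => cvgf w)) ig (aeW _ (fun w n _ => domf n w)).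
have a2 : (\int[P]_w (cst 0 w : \bar R)) < (a / 2)%:E.
  by rewrite integral0 lte_fin divr_gt0.
have : \forall n \near \oo, \int[P]_w f_ n w < (a / 2)%:E := cv _ (open_ereal_lt' a2).
move=> /filter_ex[n nl]; exists n%:R => //.
rewrite (@integral_law (fun t => neg_part (t + n%:R))%R)//; first exact: ltW.
by move=> t; exact: neg_part_ge0.
Unshelve. all: by end_near. Qed.

Hypothesis indep : mutually_independent xi.
Hypothesis same_law : forall n (A : set R), measurable A ->
  distribution P (xi n) A = law A.

(** On [0, +oo[ the mean of y |-> (y + K)^+ decreases by at least a / 2 at each
    step: taking the positive part raises the mean of y + K + xi by at most that of
    (xi + K)^-. *)
Lemma expected_hitting_time_lty : \sum_(n <oo) P (alive n) < +oo.
Proof.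
have [K K0 hK] := truncated_drift.
have [pE nE] := mean_parts.
pose V (y : R) : \bar R := (pos_part (y + K))%:E.
have mV : measurable_fun setT V.
  apply/measurable_EFinP; apply: (measurableT_comp measurable_pos_part).
  exact: measurable_funD.
have V0 y : 0 <= V y by rewrite lee_fin pos_part_ge0.
have a2 : (0 <= a / 2)%R by rewrite divr_ge0// ltW.
have drift y : y = 0%R \/ `]0%R, +oo[%classic y ->
    \int[law]_t V (y + t)%R + (a / 2)%:E <= V y.
  move=> yD; have y0 : (0 <= y)%R.
    by case: yD => [->//|/=]; rewrite in_itv/= andbT => /ltW.
  have Vy : V y = (y + K)%:E by rewrite /V /pos_part max_l// addr_ge0.
  have mVt : measurable_fun setT (fun t : R => V (y + t)%R).
    by apply: (measurableT_comp mV); exact: measurable_funD.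
  have mnK : measurable_fun setT (fun t : R => (neg_part (t + K))%:E).
    apply/measurable_EFinP; apply: (measurableT_comp measurable_neg_part).
    exact: measurable_funD.
  have mn : measurable_fun setT (fun t : R => (neg_part t)%:E).
    apply/measurable_EFinP; exact: measurable_neg_part.
  have mp : measurable_fun setT (fun t : R => (pos_part t)%:E).
    apply/measurable_EFinP; exact: measurable_pos_part.
  have H : \int[law]_t V (y + t)%R + \int[law]_t (neg_part t)%:E <=
     (y + K)%:E + \int[law]_t (pos_part t)%:E + \int[law]_t (neg_part (t + K))%:E.
    have -> : (y + K)%:E = \int[law]_t (cst (y + K)%:E t).
      rewrite integral_cst// [X in _ * X](_ : _ = 1) ?mule1//.
      exact: probability_setT.
    have mc : measurable_fun setT (cst (y + K)%:E : R -> \bar R) by [].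
    have n0 t : [set: R] t -> 0 <= (neg_part t)%:E by rewrite lee_fin neg_part_ge0.
    have p0 t : [set: R] t -> 0 <= (pos_part t)%:E by rewrite lee_fin pos_part_ge0.
    have k0 t : [set: R] t -> 0 <= (neg_part (t + K))%:E.
      by rewrite lee_fin neg_part_ge0.
    have c0 t : [set: R] t -> 0 <= (cst (y + K)%:E : R -> \bar R) t.
      by rewrite lee_fin addr_ge0.
    rewrite -ge0_integralD// -(ge0_integralD _ _ c0)//.
    rewrite -(ge0_integralD _ _ _ _ k0)//; last 2 first.
    - by move=> t _; rewrite adde_ge0 ?c0 ?p0.
    - exact: emeasurable_funD.
    apply: ge0_le_integral => //.
    - by move=> t _; rewrite adde_ge0// lee_fin neg_part_ge0.
    - exact: emeasurable_funD.
    - by apply: emeasurable_funD => //; exact: emeasurable_funD.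
    - move=> t _; rewrite /V /= -!EFinD lee_fin.
      have := pos_neg_part (y + t + K).
      have := pos_neg_part t.
      have : (neg_part (y + t + K) <= neg_part (t + K))%R.
        by apply: neg_part_nonincreasing; lra.
      lra.
  move: H; rewrite pE nE Vy => H.
  have := le_trans H (leeD2l _ hK).
  case: (\int[law]_t V (y + t)%R) => [r| |]//=; last by move=> _; rewrite leNye.
  by rewrite -!EFinD !lee_fin; lra.
have F := foster indep same_law (measurable_itv `]0%R, +oo[) mV V0 a2 drift.
have G : \sum_(n <oo) ((a / 2)%:E * P (alive n)) <= V 0%R.
  apply: le_trans F; apply: lee_nneseries => n.
    by move=> _ _; rewrite mule_ge0.
  by move=> _; rewrite leeDl// integral_ge0.
rewrite nneseriesZl// in G.
have : (a / 2)%:E * \sum_(n <oo) P (alive n) < +oo.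
  by apply: le_lt_trans G _; rewrite ltry.
case: (\sum_(n <oo) P (alive n)) => [r _| |//]; first exact: ltry.
by rewrite gt0_muley ?lte_fin ?divr_gt0.
Qed.

(** Summable probabilities tend to 0, so the walk leaves D almost surely. *)
Lemma stay_leave_total D : measurable D -> \sum_(n <oo) P (stay xi D n) < +oo ->
  \sum_(n <oo) P (leave xi D n) = 1.
Proof.
move=> mD sfin.
pose u n := fine (P (stay xi D n)).
have uE n : P (stay xi D n) = (u n)%:E.
  by rewrite fineK// fin_num_measure//; exact: measurable_stay.
have u0 n : (0 <= u n)%R by rewrite fine_ge0.
have cu : u n @[n --> \oo] --> (0 : R)%R.
  apply: cvg_series_cvg_0; apply: nnseries_is_cvg => //.
  by under eq_eseriesr do rewrite -uE.
apply/cvg_lim => //.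
have -> : (fun n => \sum_(0 <= k < n) P (leave xi D k)) = (fun n => (1 - u n)%:E).
  apply/funext => n; have := probability_leave_sum xi n mD; rewrite uE.
  case: (\sum_(0 <= k < n) P (leave xi D k)) => [r| |]//.
  by rewrite -EFinD => -[<-]; rewrite addrK.
apply: cvg_EFin; first by near=> n.
have : (1 - u n)%R @[n --> \oo] --> (1 - 0 : R)%R by apply: cvgB => //; exact: cvg_cst.
by rewrite subr0.
Unshelve. all: by end_near. Qed.

(** The step of index k.+1 belongs to the excursion if and only if the walk is
    alive at time k. *)
Definition excursion_sum (g : R -> R) (w : T) : \bar R :=
  \sum_(k <oo) (g (xi k.+1 w) * \1_(alive k) w)%:E.

Lemma measurable_excursion_sum (g : R -> R) : measurable_fun setT g ->
  (forall t, 0 <= g t)%R -> measurable_fun setT (excursion_sum g).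
Proof.
move=> mg g0; apply: ge0_emeasurable_sum => k.
  by move=> w _ _; rewrite lee_fin mulr_ge0.
move=> _; apply/measurable_EFinP; apply: measurable_funM.
  by apply: (measurableT_comp mg).
by apply: measurable_indic; exact: measurable_stay.
Qed.

Lemma excursion_sum_ge0 (g : R -> R) w : (forall t, 0 <= g t)%R ->
  0 <= excursion_sum g w.
Proof. by move=> g0; apply: nneseries_ge0 => k _ _; rewrite lee_fin mulr_ge0. Qed.

(** Whether the step k.+1 belongs to the excursion is decided by the first k steps,
    and so is independent of its value. *)
Lemma integral_excursion_sum (g : R -> R) (m c : R) : measurable_fun setT g ->
  (forall t, 0 <= g t)%R -> \sum_(n <oo) P (alive n) = m%:E ->
  \int[law]_t (g t)%:E = c%:E ->
  \int[P]_w excursion_sum g w = (m * c)%:E.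
Proof.
move=> mg g0 mE cE; rewrite integral_nneseries//; last 2 first.
- move=> k; apply/measurable_EFinP; apply: measurable_funM.
    by apply: (measurableT_comp mg).
  by apply: measurable_indic; exact: measurable_stay.
- by move=> k w _; rewrite lee_fin mulr_ge0.
rewrite EFinM -mE muleC -nneseriesZl//.
apply: eq_eseriesr => k _.
transitivity (\int[P]_(w in alive k) (g (xi k.+1 w))%:E).
  rewrite [RHS]integral_mkcond epatch_indic.
  by apply: eq_integral => w _; rewrite EFinM.
rewrite (next_step indep same_law (g := EFin \o g))//.
- by rewrite /= cE muleC.
- exact: stay_past.
- exact/measurable_EFinP.
Qed.

Lemma excursion_sum_leave (g : R -> R) n w : leave xi `]0%R, +oo[ n w ->
  excursion_sum g w = (\sum_(1 <= i < n.+2) g (xi i w))%:E.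
Proof.
move=> [an dn].
have aliveE k : (k <= n)%N -> alive k w.
  by move=> kn; exact: stay_nonincreasing kn _ an.
have leftE k : (n < k)%N -> ~ alive k w.
  by move=> nk ak; apply: dn; apply: ak; rewrite /= nk.
have -> : excursion_sum g w = \sum_(0 <= k < n.+1) (g (xi k.+1 w))%:E.
  apply: lim_near_cst => //; near=> N.
  have nN : (n.+1 <= N)%N by near: N; exact: nbhs_infty_ge.
  rewrite (big_cat_nat (leq0n n.+1) nN)/= [X in _ + X]big_nat_cond.
  rewrite [X in _ + X]big1 ?adde0.
    rewrite !big_mkord; apply: eq_bigr => k _.
    by rewrite indicE mem_set ?mulr1//; apply: aliveE; rewrite -ltnS.
  move=> k /andP[/andP[nk _] _]; rewrite indicE memNset ?mulr0//.
  exact: leftE.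
by rewrite sumEFin big_add1.
Unshelve. all: by end_near. Qed.

(** At the end of the excursion, the depth below 0 plus the sum of the positive
    parts of the steps equals the sum of their negative parts. The means of the two
    sums are m times the means of the parts of one step, which differ by a. *)
Lemma wald (m : R) : \sum_(n <oo) P (alive n) = m%:E ->
  \sum_(n <oo) \int[P]_(w in leave xi `]0%R, +oo[ n) (- S n.+1 w)%:E <= (a * m)%:E.
Proof.
move=> mE; pose D : set R := `]0%R, +oo[%classic.
have mD : measurable D by exact: measurable_itv.
have [pE nE] := mean_parts.
have mp := measurable_pos_part; have mn := measurable_neg_part.
have pE' := integral_excursion_sum mp pos_part_ge0 mE pE.
have nE' := integral_excursion_sum mn neg_part_ge0 mE nE.
have mZp := measurable_excursion_sum mp pos_part_ge0.
have mZn := measurable_excursion_sum mn neg_part_ge0.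
have Zp0 w := excursion_sum_ge0 w pos_part_ge0.
have Zn0 w := excursion_sum_ge0 w neg_part_ge0.
have mL n : measurable (leave xi D n) by exact: measurable_leave.
have tL := @trivIset_leave R d T P xi D.
pose U := \bigcup_n leave xi D n.
have mU : measurable U by exact: bigcup_measurable.
have PU : P U = 1.
  by rewrite measure_semi_bigcup// stay_leave_total// mE ltry.
have onU : \int[P]_(w in U) excursion_sum pos_part w = (m * pos_mean)%:E.
  rewrite -pE' -(setUv U) ge0_integral_setU//; last 3 first.
  - exact: measurableC.
  - by rewrite setUv.
  - exact/disj_setPCl.
  rewrite [X in _ + X]null_set_integral ?adde0//; first exact: measurableC.
  - exact: measurable_funTS.
  - by have := probability_setC P mU; rewrite PU subee.
have S0 n w : leave xi D n w -> 0 <= (- S n.+1 w)%:E.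
  move=> [_ /=]; rewrite /D/= in_itv/= andbT => /negP.
  by rewrite -leNgt lee_fin oppr_ge0.
have mS n : measurable_fun setT (fun w : T => (- S n.+1 w)%:E).
  apply/measurable_EFinP; apply: (measurableT_comp (@oppr_measurable _ _)) => //.
  exact: measurable_walk.
have sumZ (Z : T -> \bar R) : measurable_fun setT Z -> (forall w, 0 <= Z w) ->
    \sum_(n <oo) \int[P]_(w in leave xi D n) Z w = \int[P]_(w in U) Z w.
  by move=> mZ Z0; rewrite ge0_integral_bigcup//; exact: measurable_funTS.
have E : \sum_(n <oo) \int[P]_(w in leave xi D n) (- S n.+1 w)%:E
   + (m * pos_mean)%:E = \int[P]_(w in U) excursion_sum neg_part w.
  rewrite -onU -sumZ// -sumZ// -nneseriesD; last 2 first.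
  - by move=> n _ _; apply: integral_ge0 => w; exact: S0.
  - by move=> n _ _; apply: integral_ge0.
  apply: eq_eseriesr => n _; rewrite -ge0_integralD//; last 3 first.
  - by move=> w; exact: S0.
  - exact: measurable_funTS.
  - exact: measurable_funTS.
  apply: eq_integral => w; rewrite inE => Lw.
  rewrite !(excursion_sum_leave _ Lw) -EFinD; congr EFin.
  rewrite /partial_sum -sumrN -big_split/=; apply: eq_bigr => i _.
  by rewrite [in X in (- X)%R](pos_neg_part (xi i w)) opprB subrK.
have le : \int[P]_(w in U) excursion_sum neg_part w <= (m * (pos_mean + a))%:E.
  by rewrite -nE'; apply: ge0_subset_integral.
move: le; rewrite -E; case: (\sum_(n <oo) _) => [r| |]//.
  by rewrite -EFinD !lee_fin => h; move: h; lra.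
by move=> _; rewrite leNye.
Qed.

End negative_drift.

(** * The tail of the cycle maximum *)
Section cycle_maximum.
Context {R : realType} d {T : measurableType d} (P : probability T R)
  (xi : nat -> {RV P >-> R}) (F : cumulativeBounded (0 : R)%R (1 : R)%R) (a : R).
Notation S := (partial_sum xi).
Notation law := (distribution P (xi 0%N)).
Notation mu := (@lebesgue_measure R).
Notation alive := (stay xi `]0%R, +oo[).
Notation confined x := (stay xi `]0%R, x]).
Hypothesis indep : mutually_independent xi.
Hypothesis xi_cdf : forall (n : nat) (x : R), cdf (xi n) x = (F x)%:E.

Lemma same_law n (A : set R) : measurable A -> distribution P (xi n) A = law A.
Proof. by move=> mA; apply: law_of_cdf => // x; rewrite !xi_cdf. Qed.

Lemma tail_distribution n (x : R) :
  distribution P (xi n) `]x, +oo[%classic = (tail F x)%:E.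
Proof. by have := ccdf_1_cdf (xi n) x; rewrite /ccdf xi_cdf => ->. Qed.

(** As long as the walk stays in [0, x], a next step larger than x leads above x,
    and such a step is independent of the past. *)
Lemma cycle_max_lower_bound x : (0 <= x)%R ->
  (tail F x)%:E * \sum_(n <oo) P (confined x n) <=
  P [set w | x%:E < cycle_max xi w].
Proof.
move=> x0; rewrite probability_cycle_max// -nneseriesZl//.
apply: lee_nneseries => n.
  by move=> _ _; rewrite mule_ge0// lee_fin tail_ge0.
move=> _.
have := past_indep indep (next_notin_steps n) (measurable_itv `]x, +oo[)
  (@stay_past R d T P xi `]0%R, x]%classic n (measurable_itv _)).
have -> : P (xi n.+1 @^-1` `]x, +oo[) = (tail F x)%:E by exact: tail_distribution.
rewrite muleC => <-; apply: le_measure; rewrite ?inE.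
- apply: measurableI; first exact: measurable_stay.
  exact: measurable_RV_preimage.
- exact: measurable_exit_up.
- move=> w [Cw xw]; split => //; move: xw; rewrite /= !in_itv/= !andbT walkS => xw.
  have S0 : (0 <= S n w)%R.
    by case: (walk_in_domain Cw) => [->//|/=]; rewrite in_itv/= => /andP[/ltW].
  by rewrite (lt_le_trans xw)// lerDr.
Qed.

Lemma confined_nondecreasing x y n : (x <= y)%R -> confined x n `<=` confined y n.
Proof.
move=> xy w Cw k kn; have := Cw k kn; rewrite /= !in_itv/= => /andP[-> /=].
by move=> /le_trans; exact.
Qed.

Lemma confined_bigcup n : alive n = \bigcup_j confined j%:R n.
Proof.
apply/seteqP; split => [w an|w [j _]]; last exact: confined_alive.
exists (Num.truncn (\sum_(k < n.+1) `|S k w|)%R).+1 => // k kn /=.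
rewrite in_itv/=; apply/andP; split; first by have /aliveP := an; apply.
apply: le_trans (ltW (truncnS_gt _)); apply: le_trans (ler_norm _) _.
have kn1 : (k < n.+1)%N by case/andP: kn.
by rewrite (bigD1 (Ordinal kn1))//= lerDl sumr_ge0.
Qed.

(** Finitely many terms of the limit series exceed k, and each term is the
    increasing limit of the corresponding term as x grows. *)
Lemma confined_sum_near (k : R) : k%:E < \sum_(n <oo) P (alive n) ->
  \forall x \near +oo%R, k%:E < \sum_(n <oo) P (confined x n).
Proof.
move=> kA.
have [N kN] : exists N, k%:E < \sum_(0 <= n < N) P (alive n).
  have cv : \sum_(0 <= n < N) P (alive n) @[N --> \oo] --> \sum_(n <oo) P (alive n).
    exact: is_cvg_nneseries.
  have : \forall N \near \oo, k%:E < \sum_(0 <= n < N) P (alive n) :=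
    cv _ (open_ereal_gt' kA).
  by move=> /filter_ex.
have cv n : P (confined j%:R n) @[j --> \oo] --> P (alive n).
  rewrite confined_bigcup; apply: nondecreasing_cvg_mu.
  - by move=> j; exact: measurable_stay.
  - by apply: bigcup_measurable => j _; exact: measurable_stay.
  - move=> i j ij; apply/subsetPset; apply: confined_nondecreasing.
    by rewrite ler_nat.
have cvs : \sum_(0 <= n < N) P (confined j%:R n) @[j --> \oo] -->
    \sum_(0 <= n < N) P (alive n).
  apply: cvg_nnesum; first by move=> n _; apply: nearW.
  by move=> n _; exact: cv.
have : \forall j \near \oo, k%:E < \sum_(0 <= n < N) P (confined j%:R n) :=
  cvs _ (open_ereal_gt' kN).
move=> /filter_ex[j kj].
near=> x.
have jx : (j%:R <= x)%R by near: x; apply: nbhs_pinfty_ge; exact: num_real.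
apply: (lt_le_trans kj); apply: (@le_trans _ _ (\sum_(0 <= n < N) P (confined x n))).
  apply: lee_sum => n _; apply: le_measure; rewrite ?inE; [exact: measurable_stay..|].
  exact: confined_nondecreasing.
by apply: nneseries_lim_ge.
Unshelve. all: by end_near. Qed.

Section potential_of_the_walk.
Variables (b N : R).
Let g (z : R * measurableTypeR R) : \bar R :=
  (flat_tail F N z.2 * (z.1 < z.2)%R%:R * \1_(`[(- barrier F b N)%R, +oo[) z.2)%:E.

Let mg : measurable_fun setT g.
Proof.
apply/measurable_EFinP; apply: measurable_funM; first apply: measurable_funM.
- exact: (measurableT_comp (measurable_flat_tail F N)).
- rewrite [X in measurable_fun _ X](_ : _ = \1_[set z : R * R | (z.1 < z.2)%R]).
    apply: measurable_indic.
    have : measurable_fun setT (fun z : R * R => (z.1 < z.2)%R).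
      exact: measurable_fun_ltr.
    by move=> /(_ measurableT [set true]); rewrite setTI; exact.
  by apply/funext => z; rewrite indicE; congr (_%:R); congr nat_of_bool;
    apply/idP/idP; rewrite inE.
- exact: (measurableT_comp (measurable_indic _)).
Qed.

Let g0 z : 0 <= g z.
Proof. by rewrite lee_fin !mulr_ge0// tail_ge0. Qed.

Let potentialE y : potential F b N y = \int[mu]_u g (y, u).
Proof.
rewrite /potential integral_mkcond epatch_indic.
by apply: eq_integral => u _; rewrite -EFinM.
Qed.

Lemma measurable_potential : measurable_fun setT (potential F b N).
Proof.
rewrite (_ : potential F b N = fun y => \int[mu]_u g (y, u)); last first.
  by apply/funext => y; exact: potentialE.
apply: (@measurable_fun_fubini_tonelli_F _ _ R (measurableTypeR R) R mu g mg).
exact: g0.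
Qed.

(** The point u lies above z - t for a set of steps t of probability
    tail F (z - u). *)
Lemma integral_potential z : \int[law]_t potential F b N (z - t)%R =
  \int[mu]_(u in `[(- barrier F b N)%R, +oo[) (flat_tail F N u * tail F (z - u))%:E.
Proof.
under eq_integral do rewrite potentialE.
rewrite (@fubini_tonelli _ _ R (measurableTypeR R) R law mu
  (fun p => g (z - p.1, p.2)%R))//; last first.
  apply: (measurableT_comp mg); apply/measurable_fun_pairP; split => /=.
    exact: (@measurable_funB _ _ _ _ (cst z) fst).
  exact: measurable_snd.
rewrite [RHS]integral_mkcond epatch_indic; apply: eq_integral => u _.
have -> : (fun t => g (z - t, u)%R) = (fun t =>
   (flat_tail F N u * \1_(`[(- barrier F b N)%R, +oo[) u)%:E *
   (\1_(`](z - u)%R, +oo[) t)%:E).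
  apply/funext => t; rewrite /g /= -EFinM; congr EFin.
  rewrite mulrAC; congr (_ * _)%R.
  by rewrite indicE mem_setE in_itv/= andbT ltrBlDr ltrBlDl addrC.
rewrite ge0_integralZl//; last 2 first.
- exact/measurable_EFinP/measurable_indic.
- by rewrite lee_fin mulr_ge0// tail_ge0.
rewrite integral_indic// setIT.
rewrite [X in _ * X = _](_ : _ = (tail F (z - u))%:E); last exact: tail_distribution.
by rewrite -!EFinM; congr EFin; rewrite mulrAC.
Qed.

End potential_of_the_walk.

Hypothesis xi_integrable : P.-integrable setT (EFin \o xi 0%N).
Hypothesis xi_mean : 'E_P[xi 0%N] = (- a)%:E.
Hypothesis a_gt0 : (0 < a)%R.
Hypothesis F_strong : strong_subexponential F.

Lemma left_mass : \int[mu]_(u in `]-oo, 0%R[) (F u)%:E = (tail_mass F + a)%:E.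
Proof.
have := expectation_cdf_ccdf (X := xi 0%N) ((Lfun1_integrable _ _).2 xi_integrable).
rewrite xi_mean.
have -> : \int[mu]_(r in `[0%R, +oo[) ccdf (xi 0%N) r = (tail_mass F)%:E.
  rewrite -(tail_massE F_strong); apply: eq_integral => r _.
  exact: tail_distribution.
have -> : \int[mu]_(r in `]-oo, 0%R[) cdf (xi 0%N) r =
    \int[mu]_(u in `]-oo, 0%R[) (F u)%:E.
  by apply: eq_integral => r _; exact: xi_cdf.
case: integral => [r| |]//.
by rewrite -EFinB => -[h]; congr EFin; lra.
Qed.

(** [foster] applied to y |-> potential (x - y) on ]0, x + barrier]. Its initial
    value is h = [integrated_tail F x]; an exit upwards is worth at least b, and
    an exit downwards to depth s at least h - s * tail F x. The walk exits almost
    surely, and the mean depth is at most a * m by [wald]. *)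
Lemma cycle_max_upper_bound (m b N x p : R) :
  \sum_(n <oo) P (alive n) = m%:E -> (0 <= b)%R -> (0 <= N)%R -> (N <= x)%R ->
  potential_superharmonic F b N ->
  P [set w | (x + barrier F b N)%:E < cycle_max xi w] = p%:E ->
  ((b - integrated_tail F x) * p <= tail F x * (a * m))%R.
Proof.
move=> mE b0 N0 Nx super pE.
have x0 : (0 <= x)%R by exact: le_trans Nx.
set L := barrier F b N in pE *.
have L0 : (0 <= L)%R by rewrite divr_ge0// tail_ge0.
pose c := (x + L)%R; have c0 : (0 <= c)%R by rewrite addr_ge0.
pose V y := potential F b N (x - y).
have mV : measurable_fun setT V.
  apply: (measurableT_comp (measurable_potential b N)).
  exact: (@measurable_funB _ _ _ _ (cst x) id).
have V0 y : 0 <= V y by exact: potential_ge0.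
have step y : y = 0%R \/ `]0%R, c]%classic y ->
    \int[law]_t V (y + t)%R + 0%R%:E <= V y.
  move=> yD; rewrite adde0 /V.
  under eq_integral do rewrite opprD addrA.
  rewrite integral_potential; apply: super; rewrite -/L.
  by case: yD => [->|/=]; rewrite ?in_itv/= /c; lra.
have F0 := foster indep same_law (measurable_itv `]0%R, c]) mV V0 (lexx 0%R) step.
have mS (n : nat) : measurable_fun setT (fun w : T => (- S n.+1 w)%:E).
  apply/measurable_EFinP; apply: (measurableT_comp (@oppr_measurable _ _)) => //.
  exact: measurable_walk.
have mVS n : measurable_fun setT (fun w : T => V (S n.+1 w)).
  by apply: (measurableT_comp mV); exact: measurable_walk.
pose I n := \int[P]_(w in leave xi `]0%R, c] n) V (S n.+1 w).
pose W n := \int[P]_(w in exit_down xi c n) (- S n.+1 w)%:E.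
have I0 n : 0 <= I n by apply: integral_ge0.
have S0 n w : exit_down xi c n w -> 0 <= (- S n.+1 w)%:E.
  by move=> [_ /=]; rewrite in_itv/= lee_fin oppr_ge0.
have W0 n : 0 <= W n by apply: integral_ge0 => w; exact: S0.
set h := integrated_tail F x.
have h0 : (0 <= h)%R by exact: integrated_tail_ge0.
have mU n := measurable_exit_up xi c n.
have mD n := measurable_exit_down xi c n.
have perstep n : b%:E * P (exit_up xi c n) + h%:E * P (exit_down xi c n) <=
    I n + (tail F x)%:E * W n.
  rewrite /I leave_exits// ge0_integral_setU//; last 2 first.
  - exact: measurable_funTS.
  - exact/disj_set2P/exits_disjoint.
  rewrite -addeA; apply: leeD.
    rewrite -integral_cst//; apply: ge0_le_integral => //.
    - exact: measurable_funTS.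
    - move=> w [_ /=]; rewrite in_itv/= andbT => cS; apply: potential_beyond => //.
      by move: cS; rewrite /c -/L; lra.
  rewrite -ge0_integralZl//; last 3 first.
  - exact: measurable_funTS.
  - by move=> w; exact: S0.
  - by rewrite lee_fin tail_ge0.
  rewrite -ge0_integralD//; last 3 first.
  - exact: measurable_funTS.
  - by move=> w Dw; rewrite mule_ge0 ?lee_fin ?tail_ge0//; exact: S0 Dw.
  - by apply: measurable_funTS; exact: measurable_funeM.
  rewrite -integral_cst//; apply: ge0_le_integral => //.
  - by apply: measurable_funTS; apply: emeasurable_funD => //; exact: measurable_funeM.
  - move=> w Dw; have := S0 _ _ Dw; rewrite lee_fin => Sw.
    rewrite /V (potential_far F_strong)//; last by rewrite (le_trans Nx)// lerDl.
    rewrite -EFinM -EFinD lee_fin addrC mulrC.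
    exact: integrated_tail_shift.
have sumup : b%:E * p%:E + h%:E * \sum_(n <oo) P (exit_down xi c n) <=
    h%:E + (tail F x)%:E * (a * m)%:E.
  have Wle : \sum_(n <oo) W n <= (a * m)%:E.
    apply: le_trans (wald xi_integrable xi_mean indep same_law mE).
    apply: lee_nneseries => n; first by move=> _ _; exact: W0.
    move=> _; apply: ge0_subset_integral => //.
    - exact: measurable_leave.
    - exact: measurable_funTS.
    - move=> w [_ /=]; rewrite in_itv/= andbT => /negP.
      by rewrite -leNgt lee_fin oppr_ge0.
    - move=> w [Cw Sw]; split; first exact: confined_alive Cw.
      by move: Sw; rewrite /= !in_itv/= andbT => Sw; apply/negP; rewrite -leNgt.
  have Ile : \sum_(n <oo) I n <= h%:E.
    apply: (@le_trans _ _ (V 0%R)).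
      apply: le_trans F0; apply: lee_nneseries => n; first by move=> _ _; exact: I0.
      by move=> _; rewrite mul0e add0e.
    by rewrite /V subr0 (potential_far F_strong).
  apply: (@le_trans _ _
    (\sum_(n <oo) I n + (tail F x)%:E * \sum_(n <oo) W n)); last first.
    by apply: leeD => //; apply: lee_wpmul2l => //; rewrite lee_fin tail_ge0.
  rewrite -pE probability_cycle_max// -!nneseriesZl// -!nneseriesD//.
  - apply: lee_nneseries => n; last by move=> _; exact: perstep.
    by move=> _ _; rewrite adde_ge0 ?mule_ge0.
  - by move=> n _ _; rewrite mule_ge0 ?W0// lee_fin tail_ge0.
  - by move=> n _ _; rewrite mule_ge0.
  - by move=> n _ _; rewrite mule_ge0.
have total : p%:E + \sum_(n <oo) P (exit_down xi c n) = 1.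
  rewrite -pE probability_cycle_max// -nneseriesD//.
  rewrite -(@stay_leave_total _ _ _ P xi `]0%R, c]%classic)//; last first.
    apply: (@le_lt_trans _ _ m%:E); last exact: ltry.
    rewrite -mE; apply: lee_nneseries => // n _.
    by apply: le_measure; rewrite ?inE; [exact: measurable_stay..|exact: confined_alive].
  apply: eq_eseriesr => n _; rewrite leave_exits// measureU//.
  exact: exits_disjoint.
move: sumup total; case: (\sum_(n <oo) P (exit_down xi c n)) => [q| |]//.
rewrite -EFinD -!EFinM -!EFinD lee_fin => H [pq].
have : q = (1 - p)%R by lra.
by move=> qE; rewrite qE in H; lra.
Qed.

Section asymptotics.
Variable m : R.
Hypothesis mE : \sum_(n <oo) P (alive n) = m%:E.
Hypothesis m_gt0 : (0 < m)%R.

Lemma near_cycle_max_ge (e : R) : (0 < e)%R -> \forall x \near +oo%R,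
  ((1 - e) * (m * tail F x))%:E <= P [set w | x%:E < cycle_max xi w].
Proof.
move=> e0; have kA : ((1 - e) * m)%:E < \sum_(n <oo) P (alive n).
  by rewrite mE lte_fin gtr_pMl//; lra.
have conf := confined_sum_near kA.
near=> x.
have x0 : (0 <= x)%R by near: x; apply: nbhs_pinfty_ge; exact: num_real.
have kx : ((1 - e) * m)%:E < \sum_(n <oo) P (confined x n) by near: x.
apply: le_trans (cycle_max_lower_bound x0).
rewrite mulrA mulrC EFinM; apply: lee_wpmul2l; last exact: ltW.
by rewrite lee_fin tail_ge0.
Unshelve. all: by end_near. Qed.

(** The three errors, from b < a, from the integrated tail and from the shift by the
    barrier, are each a proportion s = e / 8. *)
Lemma near_cycle_max_le (e : R) : (0 < e)%R -> (e <= 1)%R ->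
  \forall x \near +oo%R,
  P [set w | x%:E < cycle_max xi w] <= ((1 + e) * (m * tail F x))%:E.
Proof.
move=> e0 e1; pose s := (e / 8)%R.
have s0 : (0 < s)%R by rewrite divr_gt0.
have s1 : (s <= 1 / 8)%R by rewrite /s; lra.
have eE : (e = 8 * s)%R by rewrite /s; lra.
pose b := (a * (1 - s))%R.
have b0 : (0 <= b)%R by rewrite mulr_ge0 ?ltW//; lra.
have ba : (b < a)%R by rewrite /b gtr_pMr//; lra.
have superN := near_potential_superharmonic F_strong b0 ba left_mass.
have [N [N0 super]] : exists N : R, (0 <= N)%R /\ potential_superharmonic F b N.
  have : \forall N \near +oo%R, (0 <= N)%R /\ potential_superharmonic F b N.
    by apply: filterI => //; apply: nbhs_pinfty_ge; exact: num_real.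
  by move=> /filter_ex.
set L := barrier F b N.
have L0 : (0 <= L)%R by rewrite divr_ge0// tail_ge0.
have [M Mh] : exists M, forall x, (M <= x)%R -> (integrated_tail F x < a * s)%R.
  have : \forall x \near +oo%R, (integrated_tail F x < a * s)%R.
    by apply: integrated_tail_near0 => //; rewrite mulr_gt0.
  by move=> /near_pinfty_forall_ge/filter_ex.
near=> y.
have yN : (N + L <= y)%R by near: y; apply: nbhs_pinfty_ge; exact: num_real.
have yM : (M + L <= y)%R by near: y; apply: nbhs_pinfty_ge; exact: num_real.
have long : (tail F (y - L) <= (1 + s) * tail F y)%R.
  by near: y; exact: tail_long.
have y0 : (0 <= y)%R by rewrite (le_trans _ yN)// addr_ge0.
pose p := fine (P [set w | y%:E < cycle_max xi w]).
have pE : P [set w | y%:E < cycle_max xi w] = p%:E.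
  by rewrite fineK// fin_num_measure//; exact: measurable_cycle_max_gt.
have p0 : (0 <= p)%R by exact: fine_ge0.
have shiftE : P [set w | ((y - L) + L)%:E < cycle_max xi w] = p%:E.
  by rewrite subrK pE.
have Ny : (N <= y - L)%R by rewrite lerBrDr.
have hy : (integrated_tail F (y - L) < a * s)%R by apply: Mh; rewrite lerBrDr.
have upper := cycle_max_upper_bound mE b0 N0 Ny super shiftE.
have Fy : (0 <= m * tail F y)%R by rewrite mulr_ge0 ?tail_ge0// ltW.
have key : (a * ((1 - 2 * s) * p) <= a * ((1 + s) * (m * tail F y)))%R.
  apply: (@le_trans _ _ (tail F (y - L) * (a * m))%R).
    by apply: le_trans upper; rewrite mulrA ler_wpM2r// /b; lra.
  have -> : (a * ((1 + s) * (m * tail F y)) = (1 + s) * tail F y * (a * m))%R.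
    by ring.
  by rewrite ler_wpM2r// mulr_ge0 ?ltW.
rewrite ler_pM2l// in key.
have ratio : (1 + s <= (1 - 2 * s) * (1 + e))%R by rewrite eE; nra.
have s2 : (0 < 1 - 2 * s)%R by lra.
rewrite pE lee_fin -(ler_pM2l s2) (le_trans key)// [leRHS]mulrA.
exact: ler_wpM2r.
Unshelve. all: by end_near. Qed.

End asymptotics.

End cycle_maximum.

Theorem corollary5 (R : realType) (d : measure_display) (T : measurableType d)
    (P : probability T R) (xi : nat -> {RV P >-> R})
    (F : cumulativeBounded (0 : R)%R (1 : R)%R) (a : R)
    (xi_indep : mutually_independent xi)
    (xi_cdf : forall (n : nat) (x : R), cdf (xi n) x = (F x)%:E)
    (xi_integrable : P.-integrable setT (EFin \o xi 0%N))
    (xi_mean : 'E_P[xi 0%N] = (- a)%:E)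
    (a_gt0 : (0 < a)%R)
    (F_strong_subexp : strong_subexponential F) :
  asymp_equiv
    (fun x : R => P [set w | x%:E < cycle_max xi w])
    (fun x : R => (\int[P]_w hitting_time xi w) * (tail F x)%:E).
Proof.
have same n A : measurable A -> _ := @same_law _ _ _ P xi F xi_cdf n A.
have finite := expected_hitting_time_lty xi_integrable xi_mean a_gt0 xi_indep same.
rewrite /asymp_equiv expected_hitting_time.
set Etau : \bar R := \sum_(n <oo) P (stay xi `]0%R, +oo[%classic n).
pose m := fine Etau.
have mE : Etau = m%:E by rewrite fineK// ge0_fin_numE//; exact: nneseries_ge0.
have m0 : (0 < m)%R.
  apply: (@lt_le_trans _ _ 1%R) => //; rewrite -lee_fin -mE.
  rewrite -(@probability_setT _ _ _ P) -(stay0 xi `]0%R, +oo[).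
  have := @nneseries_lim_ge R (fun n => P (stay xi `]0%R, +oo[%classic n)) xpredT 0 1.
  by rewrite big_nat1; apply.
rewrite mE; pose p x := fine (P [set w | x%:E < cycle_max xi w]).
have pE x : (0 <= x)%R -> P [set w | x%:E < cycle_max xi w] = (p x)%:E.
  by move=> x0; rewrite /p fineK// fin_num_measure//; exact: measurable_cycle_max_gt.
have mF x : (0 < m * tail F x)%R by rewrite mulr_gt0//; exact: tail_gt0.
have ratioE x : (0 <= x)%R ->
    P [set w | x%:E < cycle_max xi w] / (m%:E * (tail F x)%:E) =
    (p x / (m * tail F x))%:E.
  by move=> x0; rewrite pE// -EFinM inver gt_eqF// -EFinM.
apply: cvg_EFin.
  near=> x.
  have x0 : (0 <= x)%R by near: x; apply: nbhs_pinfty_ge; exact: num_real.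
  by rewrite ratioE.
apply/cvgrPdist_le => e e0; pose e' := Num.min e 1%R.
have e'0 : (0 < e')%R by rewrite lt_min e0 ltr01.
have e'1 : (e' <= 1)%R by rewrite ge_min lexx orbT.
have e'e : (e' <= e)%R by rewrite ge_min lexx.
near=> x.
have x0 : (0 <= x)%R by near: x; apply: nbhs_pinfty_ge; exact: num_real.
have lo : ((1 - e') * (m * tail F x))%:E <= P [set w | x%:E < cycle_max xi w].
  by near: x; exact: near_cycle_max_ge.
have up : P [set w | x%:E < cycle_max xi w] <= ((1 + e') * (m * tail F x))%:E.
  near: x.
  exact: (near_cycle_max_le xi_indep xi_cdf xi_integrable xi_mean a_gt0
    F_strong_subexp mE m0).
rewrite /= ratioE//= (le_trans _ e'e)// ler_norml.
rewrite pE// lee_fin -ler_pdivlMr// in lo.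
rewrite pE// lee_fin -ler_pdivrMr// in up; lra.
Unshelve. all: by end_near. Qed.
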